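(* Let $\alpha>0$ be a real number, let $\varphi$ be a real-valued $C^\infty$ function on an open interval of $\mathbb{R}$ containing $0$ whose support is compact and contained in this interval (so $\varphi$ is extended by $0$ to $\mathbb{R}$), and set $$I_\alpha(t)=\int_0^\infty \exp\!\left(i t\,\frac{1}{x^\alpha}\right)\varphi(x)\,dx\qquad (t\in\mathbb{R}).$$ For $n\in\mathbb{N}=\{1,2,\dots\}$ define $$A_n=\begin{cases}\dfrac{e^{-\frac{n}{2\alpha}\pi i}}{\alpha}\,\dfrac{\varphi^{(n-1)}(0)}{(n-1)!}\,\Gamma(-n/\alpha) & \text{if } n/\alpha\notin\mathbb{N},\\[2mm] 0 & \text{if } n/\alpha\in\mathbb{N},\end{cases} \qquad B_n=\begin{cases}-\dfrac{1}{\alpha}\,\dfrac{\varphi^{(n-1)}(0)}{(n-1)!}\,\dfrac{i^{n/\alpha}}{(n/\alpha)!} & \text{if } n/\alpha\in\mathbb{N},\\[2mm] 0 & \text{if } n/\alpha\notin\mathbb{N}.\end{cases}$$ (i) If $\alpha$ is rational, then for every positive integer $N$, $$I_\alpha(t)=\sum_{n=1}^N A_n t^{n/\alpha}+\sum_{n=1}^N B_n t^{n/\alpha}\log t+\psi_N(t)\qquad\text{for } t\in\mathbb{R}_+,$$ where $\psi_N$ is a $C^{\lceil\frac{N+1}{\alpha}\rceil-1}$ function on $\mathbb{R}_+$. (ii) If $\alpha$ is not rational, then for every positive integer $N$, $$I_\alpha(t)=\sum_{n=1}^N A_n t^{n/\alpha}+\phi_N(t)\qquad\text{for } t\in\mathbb{R}_+,$$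 where $\phi_N$ is a $C^{\lceil\frac{N+1}{\alpha}\rceil-1}$ function on $\mathbb{R}$.
   Context: $\mathbb{R}_+=\{x\in\mathbb{R}: x\ge 0\}$. $\Gamma$ is the Gamma function (meromorphically continued, so $\Gamma(-n/\alpha)$ makes sense when $n/\alpha\notin\mathbb{N}$). $\lceil a\rceil$ is the integer $m$ with $m-1<a\le m$. The expression $t^{n/\alpha}\log t$ is taken to be $0$ at $t=0$. A $C^k$ function on $\mathbb{R}_+$ is one that is $C^k$ up to the endpoint $0$ (one-sided derivatives at $0$). Functions are complex-valued unless stated otherwise. *)

(* Defs.v *)
From HB Require Import structures.
From mathcomp Require Import all_boot all_order all_algebra.
From mathcomp Require Import all_classical all_reals all_analysis.
From mathcomp.real_closed Require Export complex.
Set Implicit Arguments.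
Unset Strict Implicit.
Unset Printing Implicit Defensive.
Import Order.TTheory GRing.Theory Num.Theory.
Import numFieldNormedType.Exports.
Local Open Scope classical_set_scope.
Local Open Scope ring_scope.
Local Open Scope complex_scope.

Definition Ck_line {R : realType} (k : nat) (f : R -> R) : Prop :=
  (forall j, (j < k)%N -> forall x, derivable (derive1n j f) x 1) /\
  continuous (derive1n k f).

(* The limit is taken within A, so it is the one-sided derivative at an
   endpoint of an interval A, and only the values of f on A matter. *)
Definition has_derivative_within {R : realType} (A : set R) (f g : R -> R) :
  Prop :=
  forall x, A x ->
    (y - x)^-1 * (f y - f x) @[y --> within A x^'] --> g x.

Fixpoint Ck_within {R : realType} (A : set R) (k : nat) (f : R -> R) : Prop :=
  match k with
  | 0 => {within A, continuous f}
  | k'.+1 => exists g, has_derivative_within A f g /\ Ck_within A k' g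
  end.

(* A complex-valued function of a real variable is C^k iff its real and
   imaginary parts are. *)
Definition Ck_real_line {R : realType} (k : nat) (f : R -> R[i]) : Prop :=
  Ck_line k (fun x => complex.Re (f x)) /\ Ck_line k (fun x => complex.Im (f x)).

Definition Ck_half_line {R : realType} (k : nat) (f : R -> R[i]) : Prop :=
  let Rplus := [set x : R | 0 <= x] in
  Ck_within Rplus k (fun x => complex.Re (f x)) /\
  Ck_within Rplus k (fun x => complex.Im (f x)).

Definition smooth_on {R : realType} (J : set R) (f : R -> R) : Prop :=
  forall m x, J x -> derivable (derive1n m f) x 1.

Definition support_closure {R : realType} (f : R -> R) : set R :=
  closure [set x | f x != 0].

(* e^(i theta) *)
Definition cis {R : realType} (theta : R) : R[i] := cos theta +i* sin theta.

Definition Gamma_integral {R : realType} (s : R) : R :=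
  \int[lebesgue_measure]_(x in `]0, +oo[) (x `^ (s - 1) * expR (- x)).

(* Meromorphic continuation of Gamma, restricted to the real line:
     Gamma s = Gamma (s + k) / (s (s + 1) ... (s + k - 1)),
   with k the least natural number such that 0 < s + k. In particular k = 0
   for 0 < s. The value at the poles 0, -1, -2, ... is 0 by convention. *)
Definition Gamma {R : realType} (s : R) : R :=
  let k := Num.truncn (1 - s) in
  Gamma_integral (s + k%:R) / \prod_(i < k) (s + i%:R).

Definition complex_integral {R : realType} (D : set R) (f : R -> R[i]) : R[i] :=
  (\int[lebesgue_measure]_(x in D) complex.Re (f x)) +i*
  (\int[lebesgue_measure]_(x in D) complex.Im (f x)).

Definition I_integral {R : realType} (alpha : R) (phi : R -> R) (t : R) :
  R[i] :=
  complex_integral `]0, +oo[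
    (fun x => cis (t * (x `^ alpha)^-1) * (phi x)%:C).

Definition taylor_coef {R : realType} (phi : R -> R) (n : nat) : R :=
  derive1n n.-1 phi 0 / (n.-1)`!%:R.

Definition A_coef {R : realType} (alpha : R) (phi : R -> R) (n : nat) : R[i] :=
  if n%:R / alpha \is a Num.nat then 0
  else cis (- (n%:R / (2 * alpha) * pi)) / alpha%:C
       * (taylor_coef phi n)%:C * (Gamma (- (n%:R / alpha)))%:C.

(* When n / alpha is a natural number, it equals Num.truncn (n / alpha). *)
Definition B_coef {R : realType} (alpha : R) (phi : R -> R) (n : nat) : R[i] :=
  if n%:R / alpha \is a Num.nat then
    let m := Num.truncn (n%:R / alpha) in
    - (alpha^-1)%:C * (taylor_coef phi n)%:C * ('i%C ^+ m / m`!%:R)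
  else 0.

(* ceil ((N + 1) / alpha) - 1, which is nonnegative when 0 < alpha *)
Definition remainder_order {R : realType} (alpha : R) (N : nat) : nat :=
  absz (Num.ceil (N.+1%:R / alpha) - 1).

(* Main.v *)
Require Import Defs.
From mathcomp Require Import all_boot all_order all_algebra.
From mathcomp Require Import all_classical all_reals all_analysis.
From mathcomp Require Import measurable_realfun ring lra.
From mathcomp.real_closed Require Import complex.
Set Implicit Arguments.
Unset Strict Implicit.
Unset Printing Implicit Defensive.
Import Order.TTheory GRing.Theory Num.Theory.
Import numFieldNormedType.Exports.
Local Open Scope classical_set_scope.
Local Open Scope ring_scope.
Local Open Scope complex_scope.

(** Subtract from [phi] its Taylor polynomial of degree [N - 1] on [(0, 1]]: the
    remainder is [O(x^N)], so differentiating [k] times under the integral yields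
    [O(x^(N - k alpha))], which is integrable exactly when [k < (N + 1) / alpha].
    There remain the integrals of [x^(n-1) exp(i t x^-alpha)] over [(0, 1]].
    Rotating [t] to [t exp(-i theta)], the [theta]-derivative of
    [exp(i s theta) x^(n-1) exp(-t exp(-i theta) x^-alpha)], [s = n / alpha], is an
    exact [x]-derivative; hence, up to a term that is smooth in [t], the oscillatory
    integral is [exp(-i pi s / 2)] times the real integral of
    [x^(n-1) exp(-t x^-alpha)].  Integration by parts lowers [s] by one until
    [-1 < s <= 0], where the real integral is an incomplete Gamma function
    ([s < 0]) or an exponential integral ([s = 0]).  All remainders are smooth on
    the whole line, which gives (i) and (ii) at once. *)

(** * Calculus of pointwise derivatives *)

Section pointwise_derivatives.
Context {R : realType}.
Implicit Types (f g : R -> R) (x a b c : R).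

(** The factor [exp(i s theta)] comes from turning the ray: under [x -> exp(i theta / alpha) x], the
    power [x^-alpha] is multiplied by [exp(-i theta)] and [x^(n-1) dx] by [exp(i s theta)].
    Exactness of the derivative is thus Cauchy's theorem in real terms, and the end point [x = 1]
    contributes an integral over the arc of a function entire in [t]. The obstacle is
    [theta = pi / 2], where the exponential decay is lost and the factor [t x^-alpha] in the
    [theta]-derivative is no longer dominated. One therefore differentiates only inside
    [(0, pi / 2)] and reaches the end points by continuity, for which [x^(n-1)] alone dominates.
    Integration by parts multiplies the previous expansion by [- t / s]: it sends [t^(s-1)] to
    [t^s], [t^(s-1) ln t] to [t^s ln t], and smooth terms to smooth terms. Logarithms are born only
    at [s = 0] and so survive only at natural [n / alpha]. The base integrals diverge at [t = 0];
    the factor [t] brings this point back. Complex values are avoided until the end by carrying a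
    phase [c] in [cos (... + c)]: [c = 0] is the real part, [c = - pi / 2] the imaginary part. *)

Lemma is_derive_continuous f x a : is_derive x 1 f a -> {for x, continuous f}.
Proof. by move=> [df _]; apply/differentiable_continuous/derivable1_diffP. Qed.

(* [is_derive] is a class: were it a direct premise, [apply:] would try to infer
   it before the derivative [a] is known. *)
Lemma is_derive_congr {f x b} :
  (exists2 a, is_derive x 1 f a & a = b) -> is_derive x 1 f b.
Proof. by case=> a df <-. Qed.

Lemma is_derive_addfun {f g x a b} : is_derive x 1 f a -> is_derive x 1 g b ->
  is_derive x 1 (fun y => f y + g y) (a + b).
Proof. by move=> df dg; exact: is_deriveD. Qed.

Lemma is_derive_oppfun {f x a} : is_derive x 1 f a ->
  is_derive x 1 (fun y => - f y) (- a).
Proof. by move=> df; exact: is_deriveN. Qed.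

Lemma is_derive_mulfun {f g x a b} : is_derive x 1 f a -> is_derive x 1 g b ->
  is_derive x 1 (fun y => f y * g y) (a * g x + f x * b).
Proof.
move=> df dg; apply: is_derive_congr; exists (f x *: b + g x *: a); first exact: is_deriveM.
by rewrite addrC /GRing.scale/= mulrC.
Qed.

Lemma is_derive_constfun c x : is_derive x 1 (fun=> c) 0.
Proof. exact: is_derive_cst. Qed.

Lemma is_derive_idfun x : is_derive x 1 (fun y : R => y) 1.
Proof. exact: is_derive_id. Qed.

Lemma is_derive_compfun {h f x a b} : is_derive x 1 f a ->
  is_derive (f x) 1 h b -> is_derive x 1 (fun y => h (f y)) (b * a).
Proof. by move=> df dh; exact: is_derive1_comp. Qed.

Lemma is_derive_exprnfun {f x a n} : is_derive x 1 f a ->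
  is_derive x 1 (fun y => f y ^+ n) (n%:R * f x ^+ n.-1 * a).
Proof.
move=> df; rewrite (_ : (fun y => f y ^+ n) = f ^+ n); last first.
  by apply/funext => y; rewrite exprfctE.
exact: is_deriveX.
Qed.

Lemma is_derive_expfun {f x a} : is_derive x 1 f a ->
  is_derive x 1 (fun y => expR (f y)) (expR (f x) * a).
Proof. by move=> df; exact: is_derive_compfun. Qed.

Lemma is_derive_cosfun {f x a} : is_derive x 1 f a ->
  is_derive x 1 (fun y => cos (f y)) (- sin (f x) * a).
Proof. by move=> df; exact: is_derive_compfun. Qed.

Lemma is_derive_sinfun {f x a} : is_derive x 1 f a ->
  is_derive x 1 (fun y => sin (f y)) (cos (f x) * a).
Proof. by move=> df; exact: is_derive_compfun. Qed.

Lemma is_derive_powfun {f x a p} : 0 < f x -> is_derive x 1 f a ->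
  is_derive x 1 (fun y => f y `^ p) (p * f x `^ (p - 1) * a).
Proof.
by move=> fx df; apply: (@is_derive_compfun (fun z => z `^ p)); exact: is_derive1_powR.
Qed.

Lemma is_derive_lnfun {f x a} : 0 < f x -> is_derive x 1 f a ->
  is_derive x 1 (fun y => ln (f y)) ((f x)^-1 * a).
Proof. by move=> fx df; apply: (@is_derive_compfun (@ln R)); exact: is_derive1_ln. Qed.

End pointwise_derivatives.

(** The derivative is an existential variable filled by following the syntax of the function.
    Functions outside the listed forms are differentiated by a hypothesis in the context; positivity
    conditions of powers and logarithms are left to the caller. *)
Ltac differentiate := repeat
  (cbv beta; lazymatch goal with
  | |- is_derive _ _ (fun _ => ?c) _ =>
    simple notypeclasses refine (is_derive_constfun _ _)
  | |- is_derive _ _ (fun y => y) _ =>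
    simple notypeclasses refine (is_derive_idfun _)
  | |- is_derive _ _ (fun y => expR (@?f y)) _ =>
    simple notypeclasses refine (@is_derive_expfun _ f _ _ _)
  | |- is_derive _ _ (fun y => cos (@?f y)) _ =>
    simple notypeclasses refine (@is_derive_cosfun _ f _ _ _)
  | |- is_derive _ _ (fun y => sin (@?f y)) _ =>
    simple notypeclasses refine (@is_derive_sinfun _ f _ _ _)
  | |- is_derive _ _ (fun y => ln (@?f y)) _ =>
    simple notypeclasses refine (@is_derive_lnfun _ f _ _ _ _)
  | |- is_derive _ _ (fun y => (@?f y) ^+ _) _ =>
    simple notypeclasses refine (@is_derive_exprnfun _ f _ _ _ _)
  | |- is_derive _ _ (fun y => powR (@?f y) _) _ =>
    simple notypeclasses refine (@is_derive_powfun _ f _ _ _ _ _)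
  | |- is_derive _ _ (fun y => - (@?f y)) _ =>
    simple notypeclasses refine (@is_derive_oppfun _ f _ _ _)
  | |- is_derive _ _ (fun y => (@?f y) + (@?g y)) _ =>
    simple notypeclasses refine (@is_derive_addfun _ f g _ _ _ _ _)
  | |- is_derive _ _ (fun y => (@?f y) * (@?g y)) _ =>
    simple notypeclasses refine (@is_derive_mulfun _ f g _ _ _ _ _)
  | |- is_derive _ _ _ _ => eassumption
  end).

Ltac differentiate_to :=
  apply: is_derive_congr; eexists; [by differentiate | cbv beta].

Ltac prove_continuous := apply: is_derive_continuous; differentiate.

(** * Functions of class C^k on the line *)

(** Carrying the derivative as an explicit witness makes the closure properties plain inductions.
    The notion implies both [Ck_line] and [Ck_within] on every set. *)
Fixpoint Ck {R : realType} (k : nat) (f : R -> R) : Prop :=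
  match k with
  | 0 => continuous f
  | k'.+1 => exists2 g : R -> R, (forall x : R, is_derive x 1 f (g x)) & Ck k' g
  end.

Section Ck_theory.
Context {R : realType}.
Implicit Types (f g : R -> R) (k : nat).

Lemma CkW k f : Ck k.+1 f -> Ck k f.
Proof.
elim: k f => [f [g fg _] x|k IH f [g fg gk]]; first exact: is_derive_continuous.
by exists g => //; exact: IH.
Qed.

Lemma Ck_cst k (c : R) : Ck k (fun=> c).
Proof.
elim: k c => [c x|k IH c]; first exact: cvg_cst.
by exists (fun=> 0) => // x; exact: is_derive_constfun.
Qed.

Lemma CkD k f g : Ck k f -> Ck k g -> Ck k (fun x => f x + g x).
Proof.
elim: k f g => [f g cf cg x|k IH f g [f' df Cf] [g' dg Cg]].
  by apply: continuousD; [exact: cf|exact: cg].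
exists (fun x => f' x + g' x); last exact: IH.
by move=> x; apply: is_derive_addfun.
Qed.

Lemma CkM k f g : Ck k f -> Ck k g -> Ck k (fun x => f x * g x).
Proof.
elim: k f g => [f g cf cg x|k IH f g [f' df Cf] [g' dg Cg]].
  by apply: continuousM; [exact: cf|exact: cg].
exists (fun x => f' x * g x + f x * g' x).
  by move=> x; apply: is_derive_mulfun.
by apply: CkD; apply: IH => //; apply: CkW; [exists g'|exists f'].
Qed.

Lemma Ck_id k : Ck k (fun x : R => x).
Proof.
case: k => [x|k]; first exact: cvg_id.
exists (fun=> 1); first by move=> x; exact: is_derive_idfun.
exact: Ck_cst.
Qed.

Lemma CkZ k (c : R) f : Ck k f -> Ck k (fun x => c * f x).
Proof. by apply: CkM; exact: Ck_cst. Qed.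

Lemma CkN k f : Ck k f -> Ck k (fun x => - f x).
Proof.
move=> Cf; under eq_fun do rewrite -mulN1r; exact: CkZ.
Qed.

Lemma Ck_sum k (I : Type) (s : seq I) (F : I -> R -> R) :
  (forall i, Ck k (F i)) -> Ck k (fun x => \sum_(i <- s) F i x).
Proof.
move=> CF; elim: s => [|i s IH].
  by under eq_fun do rewrite big_nil; exact: Ck_cst.
by under eq_fun do rewrite big_cons; exact: CkD.
Qed.

Lemma Ck_exprn k n : Ck k (fun x : R => x ^+ n).
Proof.
elim: n => [|n IH]; first exact: (Ck_cst k 1).
by under eq_fun do rewrite exprS; apply: CkM => //; exact: Ck_id.
Qed.

Lemma Ck_expRN k : Ck k (fun x : R => expR (- x)).
Proof.
elim: k => [x|k IH]; first by prove_continuous.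
exists (fun x => - expR (- x)); last exact: CkN.
by move=> x; differentiate_to; rewrite mulrN1.
Qed.

Lemma Ck_line_of_Ck k f : Ck k f -> Ck_line k f.
Proof.
elim: k f => [f cf|k IH f [g df Cg]]; first by split.
have f'E : derive1 f = g.
  by apply/funext => x; rewrite derive1E; case: (df x).
have [dg cg] := IH _ Cg; split => [[_ x|j jk x]|].
- by rewrite derive1n0; case: (df x).
- by rewrite derive1Sn f'E; exact: dg.
- by rewrite derive1Sn f'E.
Qed.

Lemma Ck_within_of_Ck (A : set R) k f : Ck k f -> Ck_within A k f.
Proof.
elim: k f => [f cf|k IH f [g df Cg]]; first exact: continuous_subspaceT.
exists g; split; last exact: IH.
move=> x Ax; apply: cvg_within_filter.
have [dfx <-] := df x.
move/cvgrPdist_lt : dfx => dfx; apply/cvgrPdist_lt => e e0.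
have [d /= d0 H] := dfx _ e0; exists d => //= y yx yNx.
have := H (y - x).
rewrite /ball_ /= sub0r opprB subr_eq0 => /(_ yx yNx).
by rewrite scaler1 subrK /GRing.scale/=.
Qed.

End Ck_theory.

(** * Integrals depending on a parameter *)

Section parametric_integrals.
Context {R : realType}.
Notation mu := (@lebesgue_measure R).
Implicit Types (f g : R -> R) (D : set R).

Lemma integrable_dominated D f g : measurable D -> measurable_fun D f ->
  mu.-integrable D (EFin \o g) -> (forall x, D x -> `|f x| <= g x) ->
  mu.-integrable D (EFin \o f).
Proof.
move=> mD mf ig fg; apply: le_integrable ig => //.
  exact/measurable_EFinP.
by move=> x Dx /=; rewrite lee_fin (le_trans (fg _ Dx))// ler_norm.
Qed.

Lemma integrable_scale D c f : measurable D -> mu.-integrable D (EFin \o f) ->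
  mu.-integrable D (EFin \o (fun x => c * f x)).
Proof.
move=> mD intf.
rewrite (_ : EFin \o _ = (fun x => c%:E * (EFin \o f) x)%E)//.
exact: integrableZl.
Qed.

Lemma integrable_add D f g : measurable D -> mu.-integrable D (EFin \o f) ->
  mu.-integrable D (EFin \o g) -> mu.-integrable D (EFin \o (fun x => f x + g x)).
Proof.
move=> mD intf intg.
rewrite (_ : EFin \o _ = (EFin \o f) \+ (EFin \o g))//.
exact: integrableD.
Qed.

(** Continuity is local in [t], so the dominating function may depend on the bound [T] for [|t|].
    This matters for kernels such as [exp(- t u)], which no single function dominates for all
    [t]. *)
Lemma continuous_Rintegral D (K : R -> R -> R) : measurable D ->
  (forall t, measurable_fun D (K t)) ->
  (forall x, D x -> continuous (K ^~ x)) ->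
  (forall T, exists2 B : R -> R, mu.-integrable D (EFin \o B) &
    forall t x : R, D x -> `|t| < T -> `|K t x| <= B x) ->
  continuous (fun t => \int[mu]_(x in D) K t x).
Proof.
move=> mD mK cK dK t.
have [B iB KB] := dK (`|t| + 1).
have tT x : x \in `](- (`|t| + 1)), (`|t| + 1)[ -> `|x| < `|t| + 1.
  by rewrite in_itv/= ltr_norml.
apply: (@continuity_under_integral _ _ _ mu K D mD (- (`|t| + 1)) (`|t| + 1) _ _ B iB).
- move=> x xT; apply: (integrable_dominated mD _ iB) => // y Dy.
  by apply: KB => //; exact: tT.
- by apply: aeW => /= y Dy x _; exact: cK.
- by move=> x xT; apply: aeW => /= y Dy; apply: KB => //; exact: tT.
- by rewrite inE/= in_itv/= -ltr_norml ltrDl.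
Qed.

Lemma is_derive_Rintegral D (K dK : R -> R -> R) (u v t : R) (B : R -> R) :
  measurable D -> u < t < v ->
  (forall t, u < t < v -> mu.-integrable D (EFin \o K t)) ->
  (forall t x : R, u < t < v -> D x -> is_derive t 1 (K ^~ x) (dK t x)) ->
  mu.-integrable D (EFin \o B) ->
  (forall t x : R, u < t < v -> D x -> `|dK t x| <= B x) ->
  is_derive t 1 (fun t => \int[mu]_(x in D) K t x) (\int[mu]_(x in D) dK t x).
Proof.
move=> mD tuv iK dKE iB dKB.
have It : `]u, v[%classic t by rewrite /= in_itv.
have i1 (x : R) : `]u, v[%classic x -> mu.-integrable D (EFin \o K x).
  by rewrite /= in_itv; exact: iK.
have d1 (x y : R) : `]u, v[%classic x -> D y -> derivable (K ^~ y) x 1.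
  by rewrite /= in_itv => xuv Dy; case: (dKE _ _ xuv Dy).
have inB : mu.-integrable D (EFin \o (fun x => `|B x|)).
  exact: (integrable_norm iB).
have ub (x y : R) : `]u, v[%classic x -> D y ->
    `|partial1of2 K x y| <= `|B y|.
  rewrite /= in_itv => xuv Dy; rewrite partial1of2E.
  have [_ ->] := dKE _ _ xuv Dy.
  by rewrite (le_trans (dKB _ _ xuv Dy))// ler_norm.
have B0 y : 0 <= `|B y| by [].
have dF := @derivable_under_integral _ _ _ mu K D mD _ _ _ It i1 d1 _ B0 inB ub.
apply: DeriveDef => //; rewrite -derive1E.
rewrite (@differentiation_under_integral _ _ _ mu K D mD _ _ _ It i1 d1 _ B0 inB ub).
apply: eq_Rintegral => x; rewrite inE => Dx.
by rewrite partial1of2E; case: (dKE _ _ tuv Dx).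
Qed.

Lemma Ck_Rintegral D k (K : nat -> R -> R -> R) : measurable D ->
  (forall j, (j <= k)%N -> forall t, measurable_fun D (K j t)) ->
  (forall j, (j < k)%N -> forall t x : R, D x ->
     is_derive t 1 (K j ^~ x) (K j.+1 t x)) ->
  (forall x, D x -> continuous (K k ^~ x)) ->
  (forall j, (j <= k)%N -> forall T,
    exists2 B : R -> R, mu.-integrable D (EFin \o B) &
      forall t x : R, D x -> `|t| < T -> `|K j t x| <= B x) ->
  Ck k (fun t => \int[mu]_(x in D) K 0%N t x).
Proof.
move=> mD; elim: k K => [|k IH] K mK dK cK bK.
  by apply: continuous_Rintegral => //; [exact: mK|exact: bK].
exists (fun t => \int[mu]_(x in D) K 1%N t x); last first.
  apply: (IH (fun j => K j.+1)) => //.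
  - by move=> j jk; exact: mK.
  - by move=> j jk; exact: dK.
  - by move=> j jk; exact: bK.
move=> t.
have [B0 iB0 KB0] := bK 0%N isT (`|t| + 1).
have [B1 iB1 KB1] := bK 1%N isT (`|t| + 1).
apply: (@is_derive_Rintegral D (K 0%N) (K 1%N) (- (`|t| + 1)) (`|t| + 1) t B1) => //.
- by rewrite -ltr_norml ltrDl.
- move=> x; rewrite -ltr_norml => xT.
  apply: (integrable_dominated mD _ iB0); first exact: mK.
  by move=> y Dy; exact: KB0.
- by move=> x y _ Dy; exact: dK.
- by move=> x y; rewrite -ltr_norml => xT Dy; exact: KB1.
Qed.

End parametric_integrals.

(** * The fundamental theorem of calculus on (0, 1] *)

Section integrals_near_zero.
Context {R : realType}.
Notation mu := (@lebesgue_measure R).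
Implicit Types (f F : R -> R).

Lemma continuous_pos_measurable f :
  (forall x : R, 0 < x -> {for x, continuous f}) -> measurable_fun (`]0, +oo[%classic : set R) f.
Proof.
move=> cf; apply: open_continuous_measurable_fun; first exact: interval_open.
by move=> x; rewrite inE/= in_itv/= andbT; exact: cf.
Qed.

Lemma continuous_pos_measurable01 f :
  (forall x : R, 0 < x -> {for x, continuous f}) -> measurable_fun (`]0, 1]%classic : set R) f.
Proof.
move=> /continuous_pos_measurable; apply: measurable_funS => // x/=.
by rewrite !in_itv/= andbT => /andP[].
Qed.

(** An exhaustion of [(0, 1]] by segments, on which the fundamental theorem applies. The shift by 2
    keeps every segment nondegenerate. *)
Let A (n : nat) : set R := `[n.+2%:R^-1, 1]%classic.

Let A_bigcup : \bigcup_n A n = `]0, 1]%classic.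
Proof.
apply/seteqP; split => [x [n _]|x]; rewrite /A /= !in_itv/=.
  by move=> /andP[nx ->]; rewrite andbT (lt_le_trans _ nx)// invr_gt0.
move=> /andP[x0 x1]; exists (Num.truncn x^-1) => //=; rewrite in_itv/= x1 andbT.
rewrite invf_ple ?posrE//; apply: ltW; apply: (lt_trans (truncnS_gt _)).
by rewrite ltr_nat.
Qed.

Let A_nd : nondecreasing_seq A.
Proof.
move=> m n mn; apply/subsetPset => x; rewrite /A /= !in_itv/= => /andP[mx ->].
by rewrite andbT (le_trans _ mx)// lef_pV2 ?posrE// ler_nat.
Qed.

Let A_FTC f F (n : nat) : (forall x : R, 0 < x -> is_derive x 1 F (f x)) ->
  (forall x : R, 0 < x -> {for x, continuous f}) ->
  (\int[mu]_(x in A n) (f x)%:E = (F 1 - F n.+2%:R^-1)%:E)%E.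
Proof.
move=> dF cf.
have n1 : n.+2%:R^-1 < 1 :> R by rewrite invf_lt1// ltr1n.
have n0 : 0 < n.+2%:R^-1 :> R by rewrite invr_gt0.
rewrite EFinB; apply: continuous_FTC2 => //.
- apply: continuous_in_subspaceT => x; rewrite inE/= in_itv/= => /andP[nx _].
  by apply: cf; exact: lt_le_trans nx.
- split.
  + by move=> x; rewrite in_itv/= => /andP[nx _]; case: (dF _ (lt_trans n0 nx)).
  + by apply: cvg_at_right_filter; exact: (is_derive_continuous (dF _ n0)).
  + by apply: cvg_at_left_filter; exact: (is_derive_continuous (dF _ ltr01)).
- move=> x; rewrite in_itv/= => /andP[nx _]; rewrite derive1E.
  by case: (dF _ (lt_trans n0 nx)).
Qed.

Let A_lim F (l : R) : F x @[x --> 0^'+] --> l ->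
  (F 1 - F n.+2%:R^-1)%:E @[n --> \oo] --> (F 1 - l)%:E.
Proof.
move=> Fl; apply: cvg_EFin; first exact: nearW.
apply: cvgB; first exact: cvg_cst.
apply: ((cvg_at_rightP F 0 l).1 Fl (fun n => n.+2%:R^-1)); split.
  by move=> n; rewrite invr_gt0.
have := @cvg_harmonic R; rewrite -cvg_shiftS; exact.
Qed.

(** Monotone convergence along the exhaustion: for a nonnegative integrand, the limit of the
    primitive at 0 is the value of the integral, finiteness included. *)
Lemma ge0_FTC01 f F (l : R) : (forall x : R, 0 < x -> is_derive x 1 F (f x)) ->
  (forall x : R, 0 < x -> {for x, continuous f}) ->
  (forall x : R, 0 < x -> 0 <= f x) -> F x @[x --> 0^'+] --> l ->
  (\int[mu]_(x in `]0%R, 1%R]) (f x)%:E = (F 1 - l)%:E)%E.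
Proof.
move=> dF cf f0 Fl.
have := A_lim Fl; under eq_fun do rewrite -(A_FTC _ dF cf); move=> lim1.
have mf := continuous_pos_measurable01 cf.
have sub n : A n `<=` `]0, 1] by rewrite -A_bigcup => x Ax; exists n.
have := @ge0_nondecreasing_set_cvg_integral _ (measurableTypeR R) R A (EFin \o f) mu A_nd.
rewrite A_bigcup => lim2.
rewrite -(cvg_lim _ lim1)// -(cvg_lim _ (lim2 _ _ _))//.
- by move=> n; exact: measurable_itv.
- by move=> n; apply/measurable_EFinP; exact: measurable_funS (sub n) mf.
- move=> n x /sub; rewrite /= in_itv/= => /andP[x0 _]; rewrite lee_fin.
  exact: f0.
Qed.

Lemma ge0_integrable01 f F (l : R) : (forall x : R, 0 < x -> is_derive x 1 F (f x)) ->
  (forall x : R, 0 < x -> {for x, continuous f}) ->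
  (forall x : R, 0 < x -> 0 <= f x) -> F x @[x --> 0^'+] --> l ->
  mu.-integrable `]0, 1] (EFin \o f).
Proof.
move=> dF cf f0 Fl; apply/integrableP; split.
  by apply/measurable_EFinP; exact: continuous_pos_measurable01.
under eq_integral.
  move=> x; rewrite inE/= in_itv/= => /andP[x0 _].
  rewrite ger0_norm ?f0//; over.
by rewrite (ge0_FTC01 dF cf f0 Fl) ltry.
Qed.

(** For integrands of varying sign, the restrictions to the segments are dominated by [|f|]. *)
Lemma FTC01 f F (l : R) : (forall x : R, 0 < x -> is_derive x 1 F (f x)) ->
  (forall x : R, 0 < x -> {for x, continuous f}) ->
  mu.-integrable `]0, 1] (EFin \o f) -> F x @[x --> 0^'+] --> l ->
  \int[mu]_(x in `]0%R, 1%R]) f x = F 1 - l.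
Proof.
move=> dF cf intf Fl.
have := A_lim Fl; under eq_fun do rewrite -(A_FTC _ dF cf); move=> lim1.
have mf := continuous_pos_measurable01 cf.
have sub n : A n `<=` `]0, 1] by rewrite -A_bigcup => x Ax; exists n.
rewrite /Rintegral; suff -> : (\int[mu]_(x in `]0%R, 1%R]) (f x)%:E = (F 1 - l)%:E)%E by [].
have mA n : measurable (A n) by exact: measurable_itv.
rewrite -(cvg_lim _ lim1)//; apply/esym/cvg_lim => //.
have [] := @dominated_convergence _ (measurableTypeR R) R mu `]0, 1]%classic (measurable_itv _)
  (fun n => (EFin \o f) \_ (A n)) (EFin \o f) (fun x => `|(f x)%:E|%E).
- move=> n; apply/measurable_restrict => //; first exact: mA.
  by apply/measurable_EFinP; apply: measurable_funS mf => //; exact: subIsetl.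
- exact/measurable_EFinP.
- apply: aeW => /= x Dx; apply: (cvg_near_cst).
  have : (\bigcup_n A n) x by rewrite A_bigcup.
  case=> N _ ANx; near=> n; rewrite patchT// inE.
  have /subsetPset : A N `<=` A n.
    by apply/subsetPset; apply: A_nd; near: n; exact: nbhs_infty_ge.
  by move/subsetPset; exact.
- exact: integrable_abse.
- apply: aeW => /= x n Dx; rewrite patchE; case: ifPn => // _.
  by rewrite abse0 lee_fin.
move=> _ _; under eq_fun do rewrite -integral_mkcondr.
under eq_fun => n do rewrite (setIidr (@sub n)).
exact.
Unshelve. all: by end_near. Qed.

End integrals_near_zero.

(** * Rotation to the real exponential *)

Section rotation.
Context {R : realType}.
Notation mu := (@lebesgue_measure R).
Implicit Types (p t x : R).

Lemma powR_sub1 x p : 0 < x -> x `^ (p - 1) = x `^ p / x.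
Proof.
move=> x0; rewrite powRB; last by rewrite (gt_eqF x0) implybT.
by rewrite powRr1// ltW.
Qed.

Lemma mul_expRN_le1 (y : R) : y * expR (- y) <= 1.
Proof.
rewrite expRN ler_pdivrMr ?expR_gt0// mul1r.
by rewrite (le_trans _ (expR_ge1Dx y))// lerDr.
Qed.

Lemma integrable_powR p : 0 < p ->
  mu.-integrable `]0, 1] (EFin \o (fun x => x `^ (p - 1))).
Proof.
move=> p0; apply: (@ge0_integrable01 _ _ (fun x => p^-1 * x `^ p) 0).
- move=> x x0; differentiate_to => //.
  by rewrite mul0r add0r mulr1 mulKf ?gt_eqF.
- by move=> x x0; prove_continuous.
- by move=> x x0; exact: powR_ge0.
- by rewrite -[X in _ --> X](mulr0 p^-1); apply: cvgMr; exact: powR_cvg0.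
Qed.

Lemma integrable_powRZ (C p : R) : 0 < p ->
  mu.-integrable `]0, 1] (EFin \o (fun x => C * x `^ (p - 1))).
Proof. by move=> /integrable_powR; apply: integrable_scale; exact: measurable_itv. Qed.

Lemma cvg0_dominated (f g : R -> R) : (forall x, 0 < x -> `|f x| <= g x) ->
  g x @[x --> 0^'+] --> 0 -> f x @[x --> 0^'+] --> 0.
Proof.
move=> fg g0; apply: (@squeeze_cvgr _ _ _ _ (fun x => - g x) g) => //.
- near=> x; rewrite -ler_norml; apply: fg; near: x; exact: nbhs_right_gt.
- by rewrite -[X in _ --> X]oppr0; exact: cvgN.
Unshelve. all: by end_near. Qed.

(** For [t > 0] the exponential makes this integral converge for every real [p], which permits
    lowering [p] by [alpha] to zero and below. *)
Definition radial (alpha p t : R) : R :=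
  \int[mu]_(x in `]0, 1]) (x `^ (p - 1) * expR (- (t * x `^ (- alpha)))).

Lemma integrable_radial alpha p t : 0 < p -> 0 <= t ->
  mu.-integrable `]0, 1] (EFin \o (fun x => x `^ (p - 1) * expR (- (t * x `^ (- alpha))))).
Proof.
move=> p0 t0; apply: (integrable_dominated (measurable_itv _) _ (integrable_powR p0)).
  by apply: continuous_pos_measurable01 => x x0; prove_continuous.
move=> x _; rewrite normrM !ger0_norm ?powR_ge0 ?expR_ge0// ler_piMr ?powR_ge0//.
by rewrite -expR0 ler_expR oppr_le0 mulr_ge0 ?powR_ge0.
Qed.

Variables (alpha p : R).
Hypotheses (alpha_gt0 : 0 < alpha) (p_gt0 : 0 < p).
Notation q x := (x `^ (- alpha)).

(** The [x]-derivative of [x^p exp(- a q) sin(b q + c)], [q = x^-alpha]. With [a = r cos theta],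
    [b = r sin theta] and phase [s theta + c], it is [- alpha] times the [theta]-derivative of the
    rotated kernel. *)
Let integrand_sin (a b c x : R) := x `^ (p - 1) * expR (- (a * q x)) *
  ((p + alpha * (a * q x)) * sin (b * q x + c) - alpha * (b * q x) * cos (b * q x + c)).

Let integrand_sin_continuous a b c x : 0 < x -> {for x, continuous (integrand_sin a b c)}.
Proof. by move=> x0; rewrite /integrand_sin; prove_continuous. Qed.

(** The condition [|b| <= M a] trades the unbounded factor [b q] for [a q], which the exponential
    absorbs through [z exp(- z) <= 1]. Such an [M] exists uniformly only away from
    [theta = pi / 2]. *)
Let integrand_sin_bound (a b c M x : R) : 0 <= a -> 0 <= M -> `|b| <= M * a -> 0 < x ->
  `|integrand_sin a b c x| <= (p + alpha * (1 + M)) * x `^ (p - 1).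
Proof.
move=> a0 M0 bMa x0; rewrite /integrand_sin -mulrA normrM ger0_norm ?powR_ge0// mulrC.
apply: ler_wpM2r; first exact: powR_ge0.
have q0 : 0 <= q x := powR_ge0 _ _.
have aq0 : 0 <= a * q x by rewrite mulr_ge0.
have p0 := ltW p_gt0; have al0 := ltW alpha_gt0.
have e1 : expR (- (a * q x)) <= 1 by rewrite -expR0 ler_expR oppr_le0.
have e2 := mul_expRN_le1 (a * q x).
have e0 := expR_ge0 (- (a * q x)).
have h1 : `|(p + alpha * (a * q x)) * sin (b * q x + c)| <= p + alpha * (a * q x).
  rewrite normrM ger0_norm; last by rewrite addr_ge0// mulr_ge0.
  rewrite ler_piMr//; last by rewrite ler_norml sin_geN1 sin_le1.
  by rewrite addr_ge0// mulr_ge0.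
have h2 : `|alpha * (b * q x) * cos (b * q x + c)| <= alpha * (M * (a * q x)).
  rewrite -mulrA normrM gtr0_norm// ler_pM2l// normrM.
  apply: (@le_trans _ _ (`|b * q x| * 1)).
    by rewrite ler_wpM2l// ler_norml cos_geN1 cos_le1.
  by rewrite mulr1 normrM (ger0_norm q0) mulrA ler_wpM2r.
rewrite normrM ger0_norm//.
apply: (le_trans (ler_wpM2l e0 (le_trans (ler_normB _ _) (lerD h1 h2)))).
have -> : expR (- (a * q x)) * (p + alpha * (a * q x) + alpha * (M * (a * q x))) =
   expR (- (a * q x)) * p + alpha * (1 + M) * (a * q x * expR (- (a * q x))).
  by ring.
apply: lerD; first by rewrite ler_piMl.
by rewrite ler_piMr// mulr_ge0// addr_ge0.
Qed.

Let integrable_integrand_sin (a b c M : R) : 0 <= a -> 0 <= M -> `|b| <= M * a ->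
  mu.-integrable `]0, 1] (EFin \o integrand_sin a b c).
Proof.
move=> a0 M0 bMa.
apply: (@integrable_dominated _ _ _ (fun x => (p + alpha * (1 + M)) * x `^ (p - 1))).
- exact: measurable_itv.
- by apply: continuous_pos_measurable01 => x; exact: integrand_sin_continuous.
- exact: integrable_powRZ.
- move=> x; rewrite /= in_itv/= => /andP[x0 _].
  exact: integrand_sin_bound.
Qed.

(** The primitive vanishes at 0 because [p > 0], so only its value at [x = 1] remains. *)
Let boundary (a b c M : R) : 0 <= a -> 0 <= M -> `|b| <= M * a ->
  \int[mu]_(x in `]0, 1]) integrand_sin a b c x = expR (- a) * sin (b + c).
Proof.
move=> a0 M0 bMa.
pose P x := x `^ p * expR (- (a * q x)) * sin (b * q x + c).
have dP x : 0 < x -> is_derive x 1 P (integrand_sin a b c x).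
  move=> x0; rewrite /P /integrand_sin; differentiate_to => //.
  have -> : x `^ (- alpha - 1) = q x / x by rewrite powR_sub1.
  rewrite !powR_sub1//; field.
  by rewrite gt_eqF.
have cI x : 0 < x -> {for x, continuous (integrand_sin a b c)}.
  exact: integrand_sin_continuous.
have iI : mu.-integrable `]0, 1] (EFin \o integrand_sin a b c).
  exact: integrable_integrand_sin bMa.
have P0 : P x @[x --> 0^'+] --> 0.
  apply: (@cvg0_dominated _ (fun x => x `^ p)); last exact: powR_cvg0.
  move=> x x0; rewrite /P -mulrA normrM ger0_norm ?powR_ge0// ler_piMr ?powR_ge0//.
  rewrite normrM ger0_norm ?expR_ge0// mulr_ile1 ?expR_ge0//.
    by rewrite -expR0 ler_expR oppr_le0 mulr_ge0 ?powR_ge0.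
  by rewrite ler_norml sin_geN1 sin_le1.
rewrite (FTC01 dP cI iI P0).
by rewrite /P !powR1 !mulr1 mul1r subr0.
Qed.

Variables (r c : R).
Hypothesis r_ge0 : 0 <= r.
Notation s := (p / alpha).

Let kernel (theta x : R) := x `^ (p - 1) * expR (- (r * cos theta * q x)) *
  cos (r * sin theta * q x + (s * theta + c)).

Let arc_integrand (theta : R) := expR (- (r * cos theta)) * sin (r * sin theta + (s * theta + c)).

(* Past [pi / 2] the exponential in [kernel] grows; [`|cos theta|] keeps it bounded,
   so that the integral is continuous at [pi / 2] from both sides. *)
Let kernel_abs (theta x : R) := x `^ (p - 1) * expR (- (r * `|cos theta| * q x)) *
  cos (r * sin theta * q x + (s * theta + c)).

Let U (theta : R) := \int[mu]_(x in `]0, 1]) kernel_abs theta x.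

Let kernel_absE theta x : 0 <= cos theta -> kernel_abs theta x = kernel theta x.
Proof. by move=> c0; rewrite /kernel_abs ger0_norm. Qed.

Let kernel_abs_measurable theta : measurable_fun (`]0, 1]%classic : set R) (kernel_abs theta).
Proof. by apply: continuous_pos_measurable01 => x x0; rewrite /kernel_abs; prove_continuous. Qed.

Let kernel_abs_bound theta x : 0 < x -> `|kernel_abs theta x| <= 1 * x `^ (p - 1).
Proof.
move=> x0; rewrite /kernel_abs -mulrA normrM ger0_norm ?powR_ge0// mul1r ler_piMr ?powR_ge0//.
rewrite normrM ger0_norm ?expR_ge0// mulr_ile1 ?expR_ge0//.
  by rewrite -expR0 ler_expR oppr_le0 !mulr_ge0 ?powR_ge0.
by rewrite ler_norml cos_geN1 cos_le1.
Qed.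

Let U_continuous : continuous U.
Proof.
apply: continuous_Rintegral.
- exact: measurable_itv.
- exact: kernel_abs_measurable.
- move=> x; rewrite /= in_itv/= => /andP[x0 _] theta.
  have cN : {for theta, continuous (fun t : R => `|cos t|)}.
    apply: continuous_comp; first exact: continuous_cos.
    exact: norm_continuous.
  have cE : {for theta, continuous (fun t : R => expR (- (r * `|cos t| * q x)))}.
    apply: (@continuous_comp _ _ _ (fun t : R => `|cos t|) (fun y => expR (- (r * y * q x)))) => //.
    by prove_continuous.
  have cC : {for theta, continuous (fun t => cos (r * sin t * q x + (s * t + c)))}.
    by prove_continuous.
  exact: (cvgM (cvgM (cvg_cst _) cE) cC).
- move=> T; exists (fun x => 1 * x `^ (p - 1)); first exact: integrable_powRZ.
  move=> t x; rewrite /= in_itv/= => /andP[x0 _] _.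
  exact: kernel_abs_bound.
Qed.

Let U_derive theta : 0 < theta < pi / 2 -> is_derive theta 1 U (- alpha^-1 * arc_integrand theta).
Proof.
move=> /andP[th0 thpi].
(* On [(0, v)] the cosine is at least [cos v > 0], so [1 / cos v] serves as the constant [M] of the
   bound for all angles near [theta]. *)
pose v := (theta + pi / 2) / 2.
have v0 : 0 < v by rewrite /v; lra.
have vpi : v < pi / 2 by rewrite /v; lra.
have thv : theta < v by rewrite /v; lra.
have cosv0 : 0 < cos v by apply: cos_gt0_pihalf; rewrite vpi andbT; lra.
have cosv t : 0 < t < v -> cos v <= cos t.
  move=> /andP[t0 tv]; have pi0 := pi_gt0 R.
  apply: ltW; rewrite ltr_cos//= in_itv/=; apply/andP; split; lra.
have bint t : 0 < t < v -> [/\ 0 <= r * cos t & `|r * sin t| <= (cos v)^-1 * (r * cos t)].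
  move=> tv; have := cosv _ tv => cvt; split.
    by rewrite mulr_ge0// (le_trans _ cvt)// ltW.
  rewrite normrM ger0_norm// mulrCA ler_wpM2l//.
  rewrite (@le_trans _ _ 1)//; first by rewrite ler_norml sin_geN1 sin_le1.
  by rewrite mulrC ler_pdivlMr// mul1r.
have tint t : 0 < t < v -> 0 <= cos t.
  by move=> /cosv; apply: le_trans; exact: ltW.
have civ0 : 0 <= (cos v)^-1 by rewrite invr_ge0 ltW.
have [cth0 cthb] : [/\ 0 <= r * cos theta & `|r * sin theta| <= (cos v)^-1 * (r * cos theta)].
  by apply: bint; rewrite th0.
have -> : - alpha^-1 * arc_integrand theta = \int[mu]_(x in `]0, 1])
   (- alpha^-1 * integrand_sin (r * cos theta) (r * sin theta) (s * theta + c) x).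
  rewrite RintegralZl; first by rewrite (boundary _ cth0 civ0 cthb).
    exact: measurable_itv.
  exact: integrable_integrand_sin cthb.
apply: (@near_eq_is_derive _ _ _ (fun t => \int[mu]_(x in `]0, 1]) kernel t x)).
  near=> t; apply: eq_Rintegral => x _; rewrite kernel_absE//; apply: tint.
  suff : t \in `]0, v[ by rewrite in_itv.
  by near: t; apply: near_in_itvoo; rewrite in_itv/= th0.
pose B x := alpha^-1 * (p + alpha * (1 + (cos v)^-1)) * x `^ (p - 1).
apply: (@is_derive_Rintegral _ _ kernel
  (fun t x => - alpha^-1 * integrand_sin (r * cos t) (r * sin t) (s * t + c) x) 0 v _ B).
- exact: measurable_itv.
- by rewrite th0.
- move=> t tv; apply: (@integrable_dominated _ _ _ (fun x => 1 * x `^ (p - 1))).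
  + exact: measurable_itv.
  + by apply: continuous_pos_measurable01 => x x0; rewrite /kernel; prove_continuous.
  + exact: integrable_powRZ.
  + move=> x; rewrite /= in_itv/= => /andP[x0 _].
    by rewrite -kernel_absE ?kernel_abs_bound ?tint.
- move=> t x tv; rewrite /= in_itv/= => /andP[x0 _].
  rewrite /kernel /integrand_sin; differentiate_to.
  by field; rewrite gt_eqF.
- exact: integrable_powRZ.
- move=> t x tv; rewrite /= in_itv/= => /andP[x0 _].
  rewrite normrM normrN (@gtr0_norm _ alpha^-1) ?invr_gt0// /B -[leRHS]mulrA ler_pM2l ?invr_gt0//.
  by have [? ?] := bint _ tv; exact: integrand_sin_bound.
Unshelve. all: by end_near. Qed.

(** The fundamental theorem in [theta] for [U]: its value at [pi / 2] is the oscillatory integral,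
    its value at 0 the real one, and its derivative is a pure boundary term. *)
Lemma radial_rotation :
  \int[mu]_(x in `]0, 1]) (x `^ (p - 1) * cos (r * q x + (s * (pi / 2) + c))) =
  cos c * radial alpha p r -
  alpha^-1 * \int[mu]_(theta in `[0, pi / 2])
     (expR (- (r * cos theta)) * sin (r * sin theta + (s * theta + c))).
Proof.
have pi20 : 0 < pi / 2 :> R by rewrite divr_gt0// pi_gt0.
have arc_continuous : continuous arc_integrand.
  by move=> theta; rewrite /arc_integrand; prove_continuous.
have : (\int[mu]_(theta in `[0%R, (pi / 2)%R]) (- alpha^-1 * arc_integrand theta)%:E =
    (U (pi / 2))%:E - (U 0)%:E)%E.
  apply: continuous_FTC2 => //.
  - apply: continuous_subspaceT => theta.
    exact: (cvgM (cvg_cst _) (arc_continuous theta)).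
  - split.
    + by move=> theta; rewrite in_itv/= => /U_derive[].
    + by apply: cvg_at_right_filter; exact: U_continuous.
    + by apply: cvg_at_left_filter; exact: U_continuous.
  - by move=> theta; rewrite in_itv/= derive1E => /U_derive[].
move=> /(congr1 fine)/=; rewrite -/(Rintegral _ _ _) RintegralZl; last 2 first.
- exact: measurable_itv.
- apply: continuous_compact_integrable; first exact: segment_compact.
  exact: continuous_subspaceT.
move=> FTC; rewrite -mulNr FTC addrCA.
have -> : cos c * radial alpha p r = U 0.
  rewrite /U /radial -RintegralZl; last 2 first.
  - exact: measurable_itv.
  - exact: integrable_radial.
  apply: eq_Rintegral => x _.
  rewrite /kernel_abs cos0 sin0 normr1 !mulr1 !mulr0 mul0r !add0r mulrC.
  by [].
rewrite subrr addr0; apply: eq_Rintegral => x _.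
rewrite /kernel_abs cos_pihalf sin_pihalf normr0 !mulr1 !mulr0 mul0r oppr0 expR0 mulr1.
by [].
Qed.

End rotation.

(** * Integration by parts and the base cases *)

Section radial_asymptotics.
Context {R : realType}.
Notation mu := (@lebesgue_measure R).
Implicit Types (alpha a p s t u x y T : R).

Lemma powR_cvgNy alpha : 0 < alpha -> x `^ (- alpha) @[x --> 0^'+] --> +oo.
Proof.
move=> al0; under eq_fun do rewrite powRN.
have pos : \forall x \near (0 : R)^'+, 0 < x `^ alpha.
  by near=> x; apply: powR_gt0; near: x; exact: nbhs_right_gt.
exact: ((cvgrVy pos).2 (powR_cvg0 al0)).
Unshelve. all: by end_near. Qed.

(** Integrate the derivative of [x^p exp(- t x^-alpha)] over [(0, 1]]; [p > 0] removes the boundary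
    term at 0, even when [t = 0]. *)
Lemma radial_rec alpha p t : 0 < alpha -> 0 < p -> 0 <= t ->
  p * radial alpha p t + alpha * t * radial alpha (p - alpha) t = expR (- t).
Proof.
move=> al0 p0 t0.
pose k1 x := x `^ (p - 1) * expR (- (t * x `^ (- alpha))).
pose k2 x := t * (x `^ (p - alpha - 1) * expR (- (t * x `^ (- alpha)))).
pose F x := x `^ p * expR (- (t * x `^ (- alpha))).
have k2E x : 0 < x -> k2 x = x `^ (p - 1) * (t * x `^ (- alpha) * expR (- (t * x `^ (- alpha)))).
  move=> x0; rewrite /k2 addrAC (@powRD _ x (p - 1)); last by rewrite (gt_eqF x0) implybT.

  by ring.
have ik1 : mu.-integrable `]0, 1] (EFin \o k1) by exact: integrable_radial.
have ck2 x : 0 < x -> {for x, continuous k2} by move=> x0; rewrite /k2; prove_continuous.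
have ik2 : mu.-integrable `]0, 1] (EFin \o k2).
  apply: (integrable_dominated (measurable_itv _) _ (integrable_powR p0)).
    exact: continuous_pos_measurable01.
  move=> x; rewrite /= in_itv/= => /andP[x0 _]; rewrite k2E//.
  have tx : 0 <= t * x `^ (- alpha) by rewrite mulr_ge0 ?powR_ge0.
  rewrite ger0_norm ?mulr_ge0 ?powR_ge0 ?expR_ge0//.
  by rewrite ler_piMr ?powR_ge0// mul_expRN_le1.
have dF x : 0 < x -> is_derive x 1 F (p * k1 x + alpha * k2 x).
  move=> x0; rewrite k2E// /F /k1; differentiate_to => //.
  rewrite (powR_sub1 (- alpha))// (powR_sub1 p)//; field.
  by rewrite gt_eqF.
have ip : mu.-integrable `]0, 1] (EFin \o (fun x => p * k1 x)).
  by apply: integrable_scale => //; exact: measurable_itv.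
have ia : mu.-integrable `]0, 1] (EFin \o (fun x => alpha * k2 x)).
  by apply: integrable_scale => //; exact: measurable_itv.
have cf x : 0 < x -> {for x, continuous (fun x => p * k1 x + alpha * k2 x)}.
  by move=> x0; rewrite /k1 /k2; prove_continuous.
have F0 : F x @[x --> 0^'+] --> 0.
  apply: (@cvg0_dominated _ _ (fun x => x `^ p)); last exact: powR_cvg0.
  move=> x x0; rewrite /F normrM !ger0_norm ?powR_ge0 ?expR_ge0// ler_piMr ?powR_ge0//.
  by rewrite -expR0 ler_expR oppr_le0 mulr_ge0 ?powR_ge0.
have ipa : mu.-integrable `]0, 1] (EFin \o (fun x => p * k1 x + alpha * k2 x)).
  by apply: integrable_add => //; exact: measurable_itv.
have := FTC01 dF cf ipa F0.
rewrite RintegralD//.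
rewrite RintegralZl//.
rewrite RintegralZl//.
rewrite /F !powR1 mulr1 mul1r subr0 => <-; congr (_ + _).
rewrite -mulrA; congr (_ * _).
(* At [t = 0] the integral with exponent [p - alpha] may diverge; the factor [t] annihilates
   whatever value it is given. *)
have [t00|tN0] := eqVneq t 0.
  rewrite /k2 t00 mul0r; under eq_Rintegral do rewrite mul0r.
  by rewrite Rintegral_cst ?mul0r//; exact: measurable_itv.
rewrite /radial -RintegralZl//.
rewrite (_ : (fun _ => _) = (fun x => t^-1 * k2 x)); last first.
  by apply/funext => x; rewrite /k2 mulKf.
by apply: integrable_scale => //; exact: measurable_itv.
Qed.

(** This is the substitution [y = t x^-alpha], which maps [(0, 1]] onto [[t, +oo)], carried out on
    the primitive. It covers both the incomplete Gamma function and, for [a = 0], the exponential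
    integral. *)
Lemma radial_primitive alpha a t (g : R -> R) (L : R) : 0 < alpha -> 0 < t ->
  (forall y, 0 < y -> is_derive y 1 g (y `^ (a - 1) * expR (- y))) ->
  g y @[y --> +oo] --> L ->
  radial alpha (- (alpha * a)) t = alpha^-1 * t `^ (- a) * (L - g t).
Proof.
move=> al0 t0 dg gL.
pose F x := - (alpha^-1 * t `^ (- a)) * g (t * x `^ (- alpha)).
pose f x := x `^ (- (alpha * a) - 1) * expR (- (t * x `^ (- alpha))).
have dF x : 0 < x -> is_derive x 1 F (f x).
  move=> x0.
  have tx0 : 0 < t * x `^ (- alpha) by rewrite mulr_gt0 ?powR_gt0.
  have dgt : is_derive x 1 (fun x => g (t * x `^ (- alpha)))
     ((t * x `^ (- alpha)) `^ (a - 1) * expR (- (t * x `^ (- alpha))) *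
       (t * (- alpha * x `^ (- alpha - 1)))).
    apply: (@is_derive_compfun _ g (fun x => t * x `^ (- alpha))).
      by differentiate_to => //; rewrite mul0r add0r mulr1.
    exact: dg.
  rewrite /F; differentiate_to.
  rewrite /f mul0r add0r powRM ?powR_ge0 ?(ltW t0)//.
  rewrite !(powR_sub1 a) ?powR_gt0// (powR_sub1 (- alpha) x0) (powR_sub1 _ x0).
  rewrite -powRrM (mulNr alpha a) (powRN t); field.
  by rewrite !gt_eqF ?powR_gt0.
have Fl : F x @[x --> 0^'+] --> - (alpha^-1 * t `^ (- a)) * L.
  apply: cvgM; first exact: cvg_cst.
  apply: (cvg_comp _ _ _ gL).
  by apply: gt0_cvgMry => //; exact: powR_cvgNy.
have f0 x : 0 < x -> 0 <= f x by move=> x0; rewrite mulr_ge0 ?powR_ge0 ?expR_ge0.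
have cf x : 0 < x -> {for x, continuous f} by move=> x0; rewrite /f; prove_continuous.
rewrite /radial /Rintegral (ge0_FTC01 dF cf f0 Fl)/= /F powR1 mulr1.
by ring.
Qed.

Lemma le_is_derive (f df : R -> R) x y : x <= y ->
  (forall z, x <= z -> is_derive z 1 f (df z)) -> (forall z, x <= z -> 0 <= df z) ->
  f x <= f y.
Proof.
move=> xy dfE df0; have [z||z] := @MVT_segment R f df x y xy.
- by rewrite in_itv/= => /andP[/ltW xz _]; exact: dfE.
- apply: derivable_within_continuous => z; rewrite in_itv/= => /andP[xz _].
  by case: (dfE _ xz).
- rewrite in_itv/= => /andP[xz _] fE.
  by rewrite -subr_ge0 fE mulr_ge0 ?df0// subr_ge0.
Qed.

(** Beyond 1 the derivative of [g] lies between 0 and [exp(- y)], as [a <= 1]. Hence [g] increases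
    while [g + exp(- y)] decreases, which bounds [g]. *)
Lemma primitive_cvgy a (g : R -> R) : a <= 1 ->
  (forall y, 0 < y -> is_derive y 1 g (y `^ (a - 1) * expR (- y))) ->
  exists L : R, g y @[y --> +oo] --> L.
Proof.
move=> a1 dg.
have dg1 y : 1 <= y -> is_derive y 1 g (y `^ (a - 1) * expR (- y)).
  by move=> y1; apply: dg; exact: lt_le_trans y1.
(* Freezing [g] below 1 gives a function monotone on the whole line with the same behaviour at
   infinity. *)
pose h y := g (Num.max 1 y).
exists (sup (range h)).
have : h y @[y --> +oo] --> sup (range h).
  apply: nondecreasing_cvgr.
    move=> x y xy; rewrite /h.
    apply: (@le_is_derive _ (fun y => y `^ (a - 1) * expR (- y))).
    - by rewrite ge_max !le_max lexx xy orbT.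
    - by move=> z; rewrite ge_max => /andP[z1 _]; exact: dg1.
    - by move=> z _; rewrite mulr_ge0 ?powR_ge0 ?expR_ge0.
  exists (g 1 + expR (- 1)) => _ [y _ <-]; rewrite /h; set m := Num.max 1 y.
  have : - (g 1 + expR (- 1)) <= - (g m + expR (- m)).
    apply: (@le_is_derive (fun z => - (g z + expR (- z)))
      (fun z => (1 - z `^ (a - 1)) * expR (- z))).
    - by rewrite le_max lexx.
    - move=> z /dg1 dgz; differentiate_to; by ring.
    - move=> z z1; rewrite mulr_ge0 ?expR_ge0// subr_ge0.
      by rewrite -[leRHS](powRr0 z) ler_powR// subr_le0.
  by rewrite lerN2; apply: le_trans; rewrite lerDl expR_ge0.
apply: cvg_trans; apply: near_eq_cvg; near=> y.
by rewrite /h max_r//; near: y; exact: nbhs_pinfty_ge.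
Unshelve. all: by end_near. Qed.

(** The integral is improper at both ends. Cutting at 1 treats them separately, and the two values
    of [g 1] cancel. *)
Lemma primitive_Gamma a (g : R -> R) (L : R) :
  (forall y, 0 < y -> is_derive y 1 g (y `^ (a - 1) * expR (- y))) ->
  g y @[y --> 0^'+] --> 0 -> g y @[y --> +oo] --> L ->
  Gamma_integral a = L.
Proof.
move=> dg g0 gL.
pose f y := y `^ (a - 1) * expR (- y).
have f0 y : 0 <= f y by rewrite mulr_ge0 ?powR_ge0 ?expR_ge0.
have cf y : 0 < y -> {for y, continuous f} by move=> y0; rewrite /f; prove_continuous.
rewrite /Gamma_integral /Rintegral -/f.
have -> : `]0%R, +oo[%classic = `]0%R, 1%R]%classic `|` `]1%R, +oo[%classic :> set R.
  by rewrite -itv_bndbnd_setU// bnd_simp.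
rewrite ge0_integral_setU//=; last 3 first.
- rewrite -itv_bndbnd_setU ?bnd_simp//.
  by apply/measurable_EFinP; exact: continuous_pos_measurable.
- by move=> x _; rewrite lee_fin; exact: f0.
- apply/disj_set2P; rewrite -subset0 => x [] /=; rewrite !in_itv/= andbT.
  by move=> /andP[_ x1] /(le_lt_trans x1); rewrite ltxx.
rewrite (ge0_FTC01 dg cf (fun y _ => f0 y) g0).
rewrite integral_itv_obnd_cbnd; last first.
  apply/measurable_EFinP; apply: (measurable_funS _ _ (continuous_pos_measurable cf)) => //.
  by move=> x /=; rewrite !in_itv/= !andbT; exact: lt_trans.
rewrite (@ge0_continuous_FTC2y _ f g 1 L)//.
- by rewrite subr0 -EFinB -EFinD/= addrC subrK.
- apply: continuous_in_subspaceT => x; rewrite inE/= in_itv/= andbT => x1.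
  by apply: cf; exact: lt_le_trans x1.
- by move=> x x1; have [] := dg _ (lt_trans ltr01 x1).
- by apply: cvg_at_right_filter; exact: (is_derive_continuous (dg _ ltr01)).
- move=> x; rewrite in_itv/= andbT derive1E => x1.
  by have [] := dg _ (lt_trans ltr01 x1).
Qed.

(* [y `^ a * lower_gamma_factor a y] is the lower incomplete Gamma function. *)
Definition lower_gamma_factor a y : R :=
  \int[mu]_(u in `]0, 1]) (u `^ (a - 1) * expR (- (y * u))).

Let lower_kernel a y u := u `^ (a - 1) * expR (- (y * u)).

Let lower_kernel_bound a y u T : 0 < u <= 1 -> `|y| < T ->
  `|lower_kernel a y u| <= expR T * u `^ (a - 1).
Proof.
move=> /andP[u0 u1] yT; rewrite /lower_kernel normrM ger0_norm ?powR_ge0// mulrC.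
rewrite ler_wpM2r ?powR_ge0// (ger0_norm (expR_ge0 _)) ler_expR.
rewrite (le_trans (ler_norm _))// normrN normrM (ger0_norm (ltW u0)).
by rewrite (le_trans _ (ltW yT))// ler_piMr.
Qed.

Let lower_kernel_measurable a y : measurable_fun (`]0, 1]%classic : set R) (lower_kernel a y).
Proof. by apply: continuous_pos_measurable01 => u u0; rewrite /lower_kernel; prove_continuous. Qed.

Let lower_kernel_integrable a y : 0 < a -> mu.-integrable `]0, 1] (EFin \o lower_kernel a y).
Proof.
move=> a0; apply: (integrable_dominated (measurable_itv _) _
  (integrable_powRZ (expR (`|y| + 1)) a0)).
  exact: lower_kernel_measurable.
by move=> u; rewrite /= in_itv/= => u01; apply: lower_kernel_bound; rewrite ?ltrDl.
Qed.

Lemma is_derive_lower_gamma_factor a y : 0 < a ->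
  is_derive y 1 (lower_gamma_factor a) (- lower_gamma_factor (a + 1) y).
Proof.
move=> a0; have a10 : 0 < a + 1 by rewrite addr_gt0.
have -> : - lower_gamma_factor (a + 1) y =
    \int[mu]_(u in `]0, 1]) (-1 * lower_kernel (a + 1) y u).
  by rewrite RintegralZl ?mulN1r//; exact: lower_kernel_integrable.
apply: (@is_derive_Rintegral _ _ (lower_kernel a) (fun y u => - 1 * lower_kernel (a + 1) y u)
  (- (`|y| + 1)) (`|y| + 1) y (fun u => expR (`|y| + 1) * u `^ (a + 1 - 1))).
- exact: measurable_itv.
- by rewrite -ltr_norml ltrDl.
- by move=> t _; exact: lower_kernel_integrable.
- move=> t u _; rewrite /= in_itv/= => /andP[u0 _]; rewrite /lower_kernel; differentiate_to.
  by rewrite !powR_sub1// powRD ?(gt_eqF u0) ?implybT// powRr1 ?ltW//; field; rewrite gt_eqF.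
- exact: integrable_powRZ.
- move=> t u; rewrite -ltr_norml /= in_itv/= => tT u01.
  by rewrite normrM normrN1 mul1r; exact: lower_kernel_bound.
Qed.

(** Differentiation only changes the sign and raises [a] by one, so the induction on [k] runs over
    all positive [a]. *)
Lemma Ck_lower_gamma_factor a k : 0 < a -> Ck k (lower_gamma_factor a).
Proof.
elim: k a => [a a0 y|k IH a a0].
  exact: (is_derive_continuous (is_derive_lower_gamma_factor y a0)).
exists (fun y => - lower_gamma_factor (a + 1) y).
  by move=> y; exact: is_derive_lower_gamma_factor.
by apply: CkN; apply: IH; rewrite addr_gt0.
Qed.

(** Integrate the derivative of [u^a exp(- y u)] over [(0, 1]]. The identity is what makes
    [y^a * lower_gamma_factor a y] a primitive of [y^(a-1) exp(- y)]. *)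
Lemma lower_gamma_factor_rec a y : 0 < a ->
  a * lower_gamma_factor a y - y * lower_gamma_factor (a + 1) y = expR (- y).
Proof.
move=> a0; have a10 : 0 < a + 1 by rewrite addr_gt0.
pose F u := u `^ a * expR (- (y * u)).
pose f u := a * lower_kernel a y u + - y * lower_kernel (a + 1) y u.
have dF u : 0 < u -> is_derive u 1 F (f u).
  move=> u0; rewrite /F /f /lower_kernel; differentiate_to => //.
  by rewrite addrK powR_sub1//; field; rewrite gt_eqF.
have cf u : 0 < u -> {for u, continuous f}.
  by move=> u0; rewrite /f /lower_kernel; prove_continuous.
have i1 := integrable_scale a (measurable_itv _) (lower_kernel_integrable y a0).
have i2 := integrable_scale (- y) (measurable_itv _) (lower_kernel_integrable y a10).
have F0 : F u @[u --> 0^'+] --> 0.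
  rewrite -[X in _ --> X](mul0r (expR (- (y * 0)))); apply: cvgM; first exact: powR_cvg0.
  apply: cvg_at_right_filter.
  have : {for 0, continuous (fun u => expR (- (y * u)))} by prove_continuous.
  exact.
have := FTC01 dF cf (integrable_add (measurable_itv _) i1 i2) F0.
rewrite /f RintegralD// !RintegralZl//; try exact: lower_kernel_integrable.
by rewrite /F powR1 mul1r mulr1 subr0 mulNr.
Qed.

(** The primitive [g] runs from 0 at the origin to [Gamma a] at infinity. In
    [t^(- a) (Gamma a - g t)] the power cancels in the second term and leaves a smooth function. *)
Lemma radial_base_pos alpha a t : 0 < alpha -> 0 < a < 1 -> 0 < t ->
  radial alpha (alpha * - a) t =
  alpha^-1 * Gamma a * t `^ (- a) - alpha^-1 * lower_gamma_factor a t.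
Proof.
move=> al0 /andP[a0 a1] t0.
pose g y := y `^ a * lower_gamma_factor a y.
have dg y : 0 < y -> is_derive y 1 g (y `^ (a - 1) * expR (- y)).
  move=> y0; rewrite -(lower_gamma_factor_rec y a0).
  have := is_derive_lower_gamma_factor y a0 => dl; rewrite /g; differentiate_to => //.
  by rewrite powR_sub1//; field; rewrite gt_eqF.
have [L gL] := primitive_cvgy (ltW a1) dg.
have g0 : g y @[y --> 0^'+] --> 0.
  rewrite -[X in _ --> X](mul0r (lower_gamma_factor a 0)); apply: cvgM; first exact: powR_cvg0.
  by apply: cvg_at_right_filter; exact: (Ck_lower_gamma_factor 0 a0 0).
have -> : Gamma a = L.
  rewrite -(primitive_Gamma dg g0 gL) /Gamma.
  (* For [0 < a < 1] the continuation uses no shift, so [Gamma a] is the integral itself. *)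
  have -> : Num.truncn (1 - a) = 0%N by apply: truncn_def; apply/andP; split; lra.
  by rewrite big_ord0 divr1 addr0.
rewrite mulrN (radial_primitive al0 t0 dg gL) /g powRN.
by field; rewrite !gt_eqF ?powR_gt0.
Qed.

Let ein_kernel y u := (1 - expR (- (y * u))) * u^-1.

(** Both signs of [z] are treated because [ein] has to be smooth on the whole line. The factor [|z|]
    removes the singularity of [ein_kernel] at [u = 0]. *)
Let norm_1BexpRN (z : R) : `|1 - expR (- z)| <= `|z| * expR `|z|.
Proof.
have [z0|z0] := leP 0 z.
  rewrite (ger0_norm z0) ger0_norm; last by rewrite subr_ge0 -expR0 ler_expR oppr_le0.
  have := expR_ge1Dx (- z) => h; rewrite (@le_trans _ _ z)//; first by lra.
  by rewrite ler_peMr// -expR0 ler_expR.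
rewrite (ltr0_norm z0) ler0_norm; last first.
  by rewrite subr_le0 -expR0 ler_expR; lra.
have := expR_ge1Dx z => h.
have -> : - (1 - expR (- z)) = (1 - expR z) * expR (- z) by rewrite mulrBl -expRD subrr expR0; ring.
by rewrite ler_pM2r ?expR_gt0//; lra.
Qed.

(* The entire function Ein, with [E_1 y = Ein y - ln y - Euler's constant]. *)
Definition ein y : R := \int[mu]_(u in `]0, 1]) ein_kernel y u.

Lemma is_derive_ein y : is_derive y 1 ein (lower_gamma_factor 1 y).
Proof.
(* The dominating functions are constants; the factor [u^(1-1) = 1] only puts them in the form of
   [integrable_powRZ]. *)
apply: (@is_derive_Rintegral _ _ ein_kernel (lower_kernel 1)
  (- (`|y| + 1)) (`|y| + 1) y (fun u => expR (`|y| + 1) * u `^ (1 - 1))).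
- exact: measurable_itv.
- by rewrite -ltr_norml ltrDl.
- move=> t _; apply: (integrable_dominated (measurable_itv _) _
    (integrable_powRZ (`|t| * expR `|t|) ltr01)).
    apply: continuous_pos_measurable01 => u u0; rewrite /ein_kernel.
    apply: continuousM; first by prove_continuous.
    by apply: continuousV; [rewrite gt_eqF|exact: cvg_id].
  move=> u; rewrite /= in_itv/= => /andP[u0 u1].
  rewrite subrr powRr0 mulr1 /ein_kernel normrM (gtr0_norm (_ : 0 < u^-1)) ?invr_gt0//.
  rewrite ler_pdivrMr// (le_trans (norm_1BexpRN _))// normrM (gtr0_norm u0).
  rewrite -!mulrA ler_wpM2l// [leRHS]mulrC (ler_wpM2l (ltW u0))// ler_expR.
  by rewrite ler_piMr.
- move=> t u _; rewrite /= in_itv/= => /andP[u0 _].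
  rewrite /ein_kernel /lower_kernel; differentiate_to.
  by rewrite subrr powRr0; field; rewrite gt_eqF.
- exact: integrable_powRZ.
- by move=> t u; rewrite -ltr_norml /= in_itv/= => tT u01; exact: lower_kernel_bound.
Qed.

Lemma Ck_ein k : Ck k ein.
Proof.
apply: CkW; exists (lower_gamma_factor 1); last exact: Ck_lower_gamma_factor.
exact: is_derive_ein.
Qed.

Lemma lower_gamma_factor1 y : y * lower_gamma_factor 1 y = 1 - expR (- y).
Proof.
pose F u := - expR (- (y * u)).
have dF u : 0 < u -> is_derive u 1 F (y * lower_kernel 1 y u).
  move=> u0; rewrite /F /lower_kernel; differentiate_to.
  by rewrite subrr powRr0; ring.
have cf u : 0 < u -> {for u, continuous (fun u => y * lower_kernel 1 y u)}.
  by move=> u0; rewrite /lower_kernel; prove_continuous.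
have i1 := integrable_scale y (measurable_itv _) (lower_kernel_integrable y ltr01).
have F0 : F u @[u --> 0^'+] --> F 0.
  apply: cvg_at_right_filter.
  have : {for 0, continuous F} by rewrite /F; prove_continuous.
  exact.
have := FTC01 dF cf i1 F0.
rewrite RintegralZl//; last exact: lower_kernel_integrable.
by move=> ->; rewrite /F !mulr0 mulr1 oppr0 expR0; ring.
Qed.

(** [ln y - ein y] is a primitive of [exp(- y) / y]. Its limit [L] at infinity is minus Euler's
    constant, but its existence suffices: it joins the smooth part. *)
Lemma radial_base0 alpha : 0 < alpha -> exists L, forall t, 0 < t ->
  radial alpha 0 t = alpha^-1 * (L - ln t + ein t).
Proof.
move=> al0; pose g y := ln y - ein y.
have dg y : 0 < y -> is_derive y 1 g (y `^ (0 - 1) * expR (- y)).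
  move=> y0; have -> : expR (- y) = 1 - y * lower_gamma_factor 1 y.
    by rewrite lower_gamma_factor1; ring.
  have := is_derive_ein y => dl; rewrite /g; differentiate_to => //.
  by rewrite sub0r powR_inv1 ?ltW//; field; rewrite gt_eqF.
have [L gL] := primitive_cvgy ler01 dg.
exists L => t t0.
have := radial_primitive al0 t0 dg gL; rewrite mulr0 oppr0 powRr0 mulr1 => ->.
by rewrite /g opprB addrA addrAC.
Qed.

End radial_asymptotics.

(** * Expansion of the real integral *)

Section radial_expansion.
Context {R : realType}.
Implicit Types (alpha s t : R).

(** Passing from [- (s - 1)] to [- s] increases the least admissible shift by one, and the new
    factor of the product is [- s]. *)
Lemma Gamma_rec s : 0 < s -> Gamma (- s) = Gamma (- (s - 1)) / - s.
Proof.
move=> s0; rewrite /Gamma.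
have -> : Num.truncn (1 - - s) = (Num.truncn (1 - - (s - 1))).+1.
  have -> : 1 - - (s - 1) = s by ring.
  apply: truncn_def; have /andP[h1 h2] := truncn_itv (ltW s0).
  by move: h2; rewrite -!natr1 => h2; apply/andP; split; lra.
set k := Num.truncn _.
have -> : \prod_(i < k.+1) (- s + i%:R) = \prod_(i < k) (- (s - 1) + i%:R) * - s.
  rewrite big_ord_recl/= addr0 mulrC; congr (_ * _).
  by apply: eq_bigr => i _; rewrite /bump/= add1n -natr1; ring.
rewrite invfM mulrA.
have -> : - s + k.+1%:R = - (s - 1) + k%:R by rewrite -natr1; ring.
by [].
Qed.

Definition power_coef s : R := if s \is a Num.nat then 0 else Gamma (- s).

(** At a natural [s], where [Gamma (- s)] has a pole, the logarithm takes over; its coefficient is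
    minus the residue of Gamma at [- s]. *)
Definition log_coef s : R :=
  if s \is a Num.nat then - ((-1) ^+ Num.truncn s / (Num.truncn s)`!%:R) else 0.

Lemma natr_pred s : 0 < s -> (s - 1 \is a Num.nat) = (s \is a Num.nat).
Proof.
move=> s0; apply/idP/idP => [h|/natrP[[|m] sE]].
- by have := rpredD h (rpred1 _); rewrite subrK.
- by move: s0; rewrite sE ltxx.
- by rewrite sE -natr1 addrK.
Qed.

Lemma power_coef_rec s : 0 < s -> power_coef s = - (power_coef (s - 1) / s).
Proof.
move=> s0; rewrite /power_coef natr_pred//; case: ifP => _.
  by rewrite mul0r oppr0.
by rewrite Gamma_rec// invrN mulrN.
Qed.

Lemma log_coef_rec s : 0 < s -> log_coef s = - (log_coef (s - 1) / s).
Proof.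
move=> s0; rewrite /log_coef natr_pred//; case: ifPn => [/natrP[[|m] sE]|_].
- by move: s0; rewrite sE ltxx.
- rewrite sE -[in X in X - 1]natr1 addrK !natrK factS natrM exprS.
  by field; rewrite addrC natr1 !pnatr_eq0 /= -lt0n fact_gt0.
- by rewrite mul0r oppr0.
Qed.

Definition radial_singular alpha s t : R :=
  alpha^-1 * (power_coef s * t `^ s + log_coef s * (t `^ s * ln t)).

(** The premise concerns [t > 0] only, yet the conclusion includes [t = 0]: there the previous
    integral is multiplied by [t], and [0^s = 0] because [s > 0]. *)
Lemma radial_expansion_step alpha s (psi : R -> R) : 0 < alpha -> 0 < s ->
  (forall t, 0 < t -> radial alpha (alpha * (s - 1)) t = radial_singular alpha (s - 1) t + psi t) ->
  forall t, 0 <= t -> radial alpha (alpha * s) t = radial_singular alpha s t +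
    ((alpha * s)^-1 * expR (- t) - s^-1 * (t * psi t)).
Proof.
move=> al0 s0 H t t0; have as0 : 0 < alpha * s by rewrite mulr_gt0.
have rec := radial_rec al0 as0 t0.
have -> : radial alpha (alpha * s) t = (alpha * s)^-1 * expR (- t) -
    s^-1 * (t * radial alpha (alpha * (s - 1)) t).
  rewrite mulrBr mulr1 -rec; field.
  by rewrite !gt_eqF.
rewrite /radial_singular; move: t0; rewrite le_eqVlt => /predU1P[<-|t0].
  by rewrite powR0 ?gt_eqF//; ring.
rewrite (H _ t0) /radial_singular (power_coef_rec s0) (log_coef_rec s0) powR_sub1//.
by field; rewrite !gt_eqF.
Qed.

Lemma radial_expansion alpha s : 0 < alpha -> 0 < s ->
  exists2 psi : R -> R, forall k, Ck k psi &
    forall t, 0 <= t -> radial alpha (alpha * s) t = radial_singular alpha s t + psi t.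
Proof.
move=> al0 s0.
have step s' (psi : R -> R) : 0 < s' -> (forall k, Ck k psi) ->
  (forall t, 0 < t ->
     radial alpha (alpha * (s' - 1)) t = radial_singular alpha (s' - 1) t + psi t) ->
  exists2 psi : R -> R, forall k, Ck k psi &
    forall t, 0 <= t -> radial alpha (alpha * s') t = radial_singular alpha s' t + psi t.
  move=> s'0 Cpsi /(radial_expansion_step al0 s'0) H.
  eexists; last exact: H.
  move=> k; apply: CkD; first by apply: CkZ; exact: Ck_expRN.
  by apply: CkN; apply: CkZ; apply: CkM => //; exact: Ck_id.
(* One step from this range reaches every [s] in [(0, 1]], and induction on a natural upper bound of
   [s] does the rest. At [t = 0] the base integrals diverge, hence [0 < t]. *)
suff base s' : -1 < s' <= 0 -> exists2 psi : R -> R, forall k, Ck k psi &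
    forall t, 0 < t -> radial alpha (alpha * s') t = radial_singular alpha s' t + psi t.
  have [m sm] : exists m : nat, s <= m%:R.
    by exists (Num.truncn s).+1; apply: ltW; exact: truncnS_gt.
  elim: m s s0 sm => [s s0 /(lt_le_trans s0)|m IH s s0 sm]; first by rewrite ltxx.
  have [s1|s1] := leP s 1.
    have /base[psi Cpsi H] : -1 < s - 1 <= 0 by apply/andP; split; lra.
    exact: step H.
  have [||psi Cpsi H] := IH (s - 1).
  - by rewrite subr_gt0.
  - by rewrite lerBlDr natr1.
  - by apply: (step _ psi) => // t /ltW; exact: H.
move=> /andP[s1]; rewrite le_eqVlt => /predU1P[->|s'0].
  have [L HL] := radial_base0 al0.
  exists (fun t => alpha^-1 * L + alpha^-1 * ein t).
    by move=> k; apply: CkD; [exact: Ck_cst | apply: CkZ; exact: Ck_ein].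
  move=> t t0; rewrite mulr0 HL// /radial_singular /power_coef /log_coef.
  rewrite rpred0 truncn0 fact0 expr0 divr1 powRr0; ring.
have a01 : 0 < - s' < 1 by apply/andP; split; lra.
have s'N : (s' \is a Num.nat) = false.
  by apply/negP => /natrP[m sE]; move: s'0; rewrite sE ltNge ler0n.
exists (fun t => - (alpha^-1 * lower_gamma_factor (- s') t)).
  by move=> k; apply: CkN; apply: CkZ; apply: Ck_lower_gamma_factor; case/andP: a01.
move=> t t0; have := radial_base_pos al0 a01 t0; rewrite opprK => ->.
by rewrite /radial_singular /power_coef /log_coef s'N; ring.
Qed.

End radial_expansion.

(** * Smooth parts *)

Section smooth_parts.
Context {R : realType}.
Notation mu := (@lebesgue_measure R).
Implicit Types (f h : R -> R) (t x : R).

Lemma Ck_arc (s d : R) k :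
  Ck k (fun t : R => \int[mu]_(theta in `[0, pi / 2])
     (expR (- (t * cos theta)) * sin (t * sin theta + (s * theta + d)))).
Proof.
(* Each [t]-derivative of [exp(- t exp(-i theta))] multiplies it by [- exp(-i theta)]: a sign and a
   phase shift by [- theta]. *)
pose K (j : nat) (t theta : R) := (-1) ^+ j *
  (expR (- (t * cos theta)) * sin (t * sin theta + (s * theta + d) - j%:R * theta)).
have -> : (fun t : R => \int[mu]_(theta in `[0, pi / 2])
     (expR (- (t * cos theta)) * sin (t * sin theta + (s * theta + d)))) =
     (fun t => \int[mu]_(theta in `[0, pi / 2]) K 0%N t theta).
  apply/funext => t; apply: eq_Rintegral => theta _.
  by rewrite /K expr0 mul1r mul0r subr0.
have cK j t : continuous (K j t) by move=> theta; rewrite /K; prove_continuous.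
apply: Ck_Rintegral.
- exact: measurable_itv.
- by move=> j _ t; apply: measurable_funTS; exact: continuous_measurable_fun.
- move=> j _ t theta _; rewrite /K; differentiate_to.
  set A := t * sin theta + (s * theta + d) - j%:R * theta.
  have -> : t * sin theta + (s * theta + d) - j.+1%:R * theta = A - theta.
    by rewrite -natr1 /A; ring.
  by rewrite (sinB A) exprS; ring.
- by move=> theta _ t; rewrite /K; prove_continuous.
- move=> j _ T; exists (fun=> expR T).
    apply: continuous_compact_integrable; first exact: segment_compact.
    by apply: continuous_subspaceT => ?; exact: cvg_cst.
  move=> t theta _ tT; rewrite /K normrM normrX normrN1 expr1n mul1r normrM ger0_norm ?expR_ge0//.
  rewrite -[leRHS]mulr1 ler_pM ?expR_ge0//; last by rewrite ler_norml sin_geN1 sin_le1.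
  rewrite ler_expR (le_trans (ler_norm _))// normrN normrM (le_trans _ (ltW tT))//.
  by rewrite ler_piMr// ler_norml cos_geN1 cos_le1.
Qed.

Lemma Ck_oscillatory (D : set R) (alpha c : R) h k : measurable D ->
  (forall x, D x -> 0 < x) -> (forall x, {for x, continuous h}) ->
  (forall j, (j <= k)%N -> exists2 B : R -> R, mu.-integrable D (EFin \o B) &
    forall x, D x -> `|(x `^ (- alpha)) ^+ j * h x| <= B x) ->
  Ck k (fun t => \int[mu]_(x in D) (cos (t * x `^ (- alpha) + c) * h x)).
Proof.
move=> mD D0 ch hB.
(* Each [t]-derivative produces a factor [x^-alpha] and advances the phase by [pi / 2]. *)
pose K (j : nat) t x :=
  cos (t * x `^ (- alpha) + c + j%:R * (pi / 2)) * ((x `^ (- alpha)) ^+ j * h x).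
have -> : (fun t : R => \int[mu]_(x in D) (cos (t * x `^ (- alpha) + c) * h x)) =
     (fun t => \int[mu]_(x in D) K 0%N t x).
  apply/funext => t; apply: eq_Rintegral => x _.
  by rewrite /K expr0 mul1r mul0r addr0.
have D0oo : D `<=` `]0, +oo[ by move=> x /D0; rewrite /= in_itv/= andbT.
apply: Ck_Rintegral => //.
- move=> j _ t; apply: (measurable_funS _ D0oo) => //.
  apply: continuous_pos_measurable => x x0; rewrite /K.
  apply: continuousM; first by prove_continuous.
  by apply: continuousM; [prove_continuous|exact: ch].
- move=> j _ t x _; rewrite /K; differentiate_to.
  have -> : t * x `^ (- alpha) + c + j.+1%:R * (pi / 2) =
      t * x `^ (- alpha) + c + j%:R * (pi / 2) + pi / 2 by rewrite -natr1; ring.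
  by rewrite cosDpihalf exprS; ring.
- by move=> x _ t; rewrite /K; prove_continuous.
- move=> j jk T; have [B iB hB'] := hB j jk; exists B => // t x Dx _.
  rewrite /K normrM (le_trans _ (hB' x Dx))// ler_piMl//.
  by rewrite ler_norml cos_geN1 cos_le1.
Qed.

Lemma derivable_continuous f x : derivable f x 1 -> {for x, continuous f}.
Proof. by move=> df; apply/differentiable_continuous/derivable1_diffP. Qed.

(** Only the order [x^N] matters, so the factor [1 / N!] is given up. Then the mean value theorem
    and the bound for the derivative, whose remainder is the derivative of the remainder of [f],
    close the induction. *)
Lemma Taylor_remainder (N : nat) f M :
  (forall m x, derivable (derive1n m f) x 1) ->
  (forall x, 0 <= x <= 1 -> `|derive1n N f x| <= M) ->
  forall x, 0 <= x <= 1 ->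
    `|f x - \sum_(i < N) derive1n i f 0 / i`!%:R * x ^+ i| <= M * x ^+ N.
Proof.
elim: N f => [|N IH] f df fM x x01.
  by rewrite big_ord0 subr0 expr0 mulr1; exact: fM.
pose f' : R -> R := derive1 f.
have df' m (y : R) : derivable (derive1n m f') y 1 by rewrite /f' -derive1Sn; exact: df.
have f'M (y : R) : 0 <= y <= 1 -> `|derive1n N f' y| <= M.
  by rewrite /f' -derive1Sn; exact: fM.
pose g y := f y - \sum_(i < N.+1) derive1n i f 0 / i`!%:R * y ^+ i.
pose g' (y : R) : R := f' y - \sum_(i < N) derive1n i f' 0 / i`!%:R * y ^+ i.
have dsum (y : R) n (a : nat -> R) :
  is_derive y 1 (fun y => \sum_(i < n.+1) a i / i`!%:R * y ^+ i)
     (\sum_(i < n) a i.+1 / i`!%:R * y ^+ i).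
  elim: n => [|n IHn].
    under eq_fun do rewrite big_ord_recl big_ord0 addr0 expr0 mulr1.
    by rewrite big_ord0; exact: is_derive_constfun.
  under eq_fun do rewrite big_ord_recr/=.
  rewrite big_ord_recr/=; apply: (is_derive_addfun IHn).
  differentiate_to; rewrite mul0r add0r mulr1 factS natrM; field.
  by rewrite addrC natr1 !pnatr_eq0 /= -lt0n fact_gt0.
have dg (y : R) : is_derive y 1 g (g' y).
  rewrite /g /g'; simple notypeclasses refine (is_derive_addfun _ _).
    by rewrite /f' derive1E; apply/derivableP; exact: (df 0%N).
  simple notypeclasses refine (is_derive_oppfun _).
  have -> : \sum_(i < N) derive1n i f' 0 / i`!%:R * y ^+ i =
     \sum_(i < N) derive1n i.+1 f 0 / i`!%:R * y ^+ i.
    by apply: eq_bigr => i _; rewrite derive1Sn.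
  exact: (dsum y N (fun i => derive1n i f 0)).
have g0 : g 0 = 0.
  rewrite /g big_ord_recl big1 ?addr0/=; last by move=> i _; rewrite expr0n/= mulr0.
  by rewrite fact0 divr1 expr0 mulr1 subrr.
have [x0 x1] := andP x01.
rewrite -/(g x).
have [|y] := @MVT_segment R g g' 0 x x0 (fun y _ => dg y).
- by apply: continuous_subspaceT => y; exact: (is_derive_continuous (dg y)).
- rewrite in_itv/= => /andP[y0 yx]; rewrite g0 !subr0 => ->.
  rewrite normrM (ger0_norm x0) exprSr mulrA ler_wpM2r//.
  apply: (le_trans (IH f' df' f'M y _)); first by rewrite y0 (le_trans yx).
  have M0 : 0 <= M by apply: le_trans (fM 0 _); rewrite ?lexx ?ler01.
  by rewrite ler_wpM2l// lerXn2r.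
Qed.

(** Off the closed support [f] vanishes on an open set, hence so do all its derivatives; smoothness
    on [J] thus extends to the line. *)
Lemma derivable_derive1n_support (J : set R) f : smooth_on J f ->
  support_closure f `<=` J -> forall m x, derivable (derive1n m f) x 1.
Proof.
move=> fJ fsupp m x; have [/fsupp Jx|Nx] := pselect (support_closure f x).
  exact: fJ.
have nf : \forall y \near x, derive1n m f y = 0.
  have O : open (~` support_closure f) by apply: closed_openC; exact: closed_closure.
  suff fO y : (~` support_closure f) y -> derive1n m f y = 0.
    by near=> y; apply: fO; near: y; exact: open_nbhs_nbhs.
  elim: m y => [|m IH] y Oy.
    apply/eqP/negPn/negP => fy; apply: Oy; exact: subset_closure.
  rewrite derive1nS derive1E -(derive_cst (0 : R) y 1); apply: near_eq_derive.
  by near=> z; apply: IH; near: z; exact: open_nbhs_nbhs.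
apply: (@near_eq_derivable _ _ _ (cst 0)); last exact: derivable_cst.
by near=> y; apply/esym; near: y.
Unshelve. all: by end_near. Qed.

Lemma compact_support_bounded f : continuous f -> compact (support_closure f) ->
  exists2 M : R, 0 <= M & exists2 X : R, 1 <= X &
    forall x, 0 < x -> `|f x| <= M * \1_`[0, X] x.
Proof.
move=> cf /compact_bounded[C [_ fC]].
(* The support is bounded by every number strictly above [C], whence [C + 1]. *)
pose X := Num.max 1 (C + 1).
have X1 : 1 <= X by rewrite le_max lexx.
have fX x : X < x -> f x = 0.
  move=> Xx; apply/eqP/negPn/negP => fx.
  have : `|x| <= X.
    apply: fC; last exact: subset_closure.
    by rewrite (@lt_le_trans _ _ (C + 1)) ?ltrDl// le_max lexx orbT.
  by rewrite leNgt (lt_le_trans Xx)// ler_norm.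
have cfn : {within `[0, X], continuous (fun x => `|f x|)}.
  by apply: continuous_subspaceT => x; apply: cvg_norm; exact: cf.
have [c _ fc] := EVT_max (le_trans ler01 X1) cfn.
exists `|f c| => //; exists X => // x x0; rewrite indicE.
have [xX|Xx] := leP x X; last by rewrite fX// normr0 mulr_ge0.
rewrite mem_set ?mulr1; last by rewrite /= in_itv/= xX ltW.
by apply: fc; rewrite in_itv/= xX ltW.
Qed.
End smooth_parts.

(** * Expansion of the oscillatory integral *)

Section oscillatory_expansion.
Context {R : realType}.
Notation mu := (@lebesgue_measure R).
Implicit Types (f : R -> R) (t x : R).

Lemma integrable_Rsum (D : set R) n (F : nat -> R -> R) : measurable D ->
  (forall i, mu.-integrable D (EFin \o F i)) ->
  mu.-integrable D (EFin \o (fun x => \sum_(i < n) F i x)).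
Proof.
move=> mD iF; elim: n => [|n IH].
  under [X in EFin \o X]eq_fun do rewrite big_ord0.
  exact: integrable0.
under [X in EFin \o X]eq_fun do rewrite big_ord_recr/=.
exact: integrable_add.
Qed.

Lemma Rintegral_sum (D : set R) n (F : nat -> R -> R) : measurable D ->
  (forall i, mu.-integrable D (EFin \o F i)) ->
  \int[mu]_(x in D) (\sum_(i < n) F i x) = \sum_(i < n) \int[mu]_(x in D) F i x.
Proof.
move=> mD iF; elim: n => [|n IH].
  under eq_Rintegral do rewrite big_ord0.
  by rewrite Rintegral_cst// mul0r big_ord0.
under eq_Rintegral do rewrite big_ord_recr/=.
by rewrite RintegralD//; [rewrite IH big_ord_recr|exact: integrable_Rsum].
Qed.

Lemma monomial_expansion (alpha c : R) (i : nat) : 0 < alpha ->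
  exists2 psi : R -> R, forall k, Ck k psi &
  forall t, 0 <= t ->
  \int[mu]_(x in `]0, 1]) (x ^+ i * cos (t * x `^ (- alpha) + c)) =
  cos (c - i.+1%:R / alpha * (pi / 2)) * radial_singular alpha (i.+1%:R / alpha) t + psi t.
Proof.
move=> al0; set s : R := i.+1%:R / alpha.
have s0 : 0 < s by rewrite divr_gt0.
have [psi Cpsi Hpsi] := radial_expansion al0 s0.
(* The rotation adds [s pi / 2] to the phase; starting from [d] it ends at [c]. *)
set d := c - s * (pi / 2).
exists (fun t => cos d * psi t - alpha^-1 * \int[mu]_(theta in `[0, pi / 2])
     (expR (- (t * cos theta)) * sin (t * sin theta + (s * theta + d)))).
  move=> k; apply: CkD; first exact: CkZ.
  by apply: CkN; apply: CkZ; exact: Ck_arc.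
move=> t t0; rewrite addrA -mulrDr -Hpsi//.
have -> : alpha * s = i.+1%:R by rewrite /s mulrC divfK ?gt_eqF.
rewrite -(radial_rotation al0 (ltr0Sn _ _) d t0); apply: eq_Rintegral => x.
rewrite inE/= in_itv/= => /andP[x0 _].
rewrite -/s (_ : s * (pi / 2) + d = c); last by rewrite /d addrC subrK.
by rewrite -natr1 addrK powR_mulrn ?(ltW x0).
Qed.

(** Cutting at 1 keeps the monomials integrable, and beyond 1 the factor [x^-alpha] is at most 1, so
    the tail is dominated by the bound on [f] whatever the order of differentiation. *)
Lemma oscillatory_expansion (alpha c M X : R) (N k : nat) f : 0 < alpha ->
  alpha * k%:R < N.+1%:R ->
  (forall m x, derivable (derive1n m f) x 1) -> 1 <= X ->
  (forall x, 0 < x -> `|f x| <= M * \1_`[0, X] x) ->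
  exists2 psi : R -> R, Ck k psi &
  forall t, 0 <= t ->
  \int[mu]_(x in `]0, +oo[) (cos (t * x `^ (- alpha) + c) * f x) =
  \sum_(i < N) derive1n i f 0 / i`!%:R * (cos (c - i.+1%:R / alpha * (pi / 2)) *
    radial_singular alpha (i.+1%:R / alpha) t) + psi t.
Proof.
move=> al0 alk df X1 fM.
pose a i := derive1n i f 0 / i`!%:R.
pose P x := \sum_(i < N) a i * x ^+ i.
have cf x : {for x, continuous f} by apply: derivable_continuous; exact: (df 0%N).
have cP x : {for x, continuous P}.
  have : Ck 0 P by apply: Ck_sum => i; apply: CkZ; exact: Ck_exprn.
  exact.
have [K fK] : exists K, forall x, 0 <= x <= 1 -> `|f x - P x| <= K * x ^+ N.
  have cfN : {within `[0, 1], continuous (fun x => `|derive1n N f x|)}.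
    apply: continuous_subspaceT => x; apply: cvg_norm.
    by apply: derivable_continuous; exact: df.
  have [y _ fy] := EVT_max ler01 cfN.
  by exists `|derive1n N f y|; apply: Taylor_remainder => //.
have mD1 : measurable (`]0, 1]%classic : set R) by exact: measurable_itv.
have mD2 : measurable (`]1, +oo[%classic : set R) by exact: measurable_itv.
have mD : measurable (`]0, +oo[%classic : set R) by exact: measurable_itv.
have iB (D : set R) : measurable D -> mu.-integrable D (EFin \o (fun x => M * \1_`[0, X] x)).
  move=> mD'; apply: integrable_scale => //.
  apply: (integrableS measurableT) => //; exact: integrable_indic_itv.
pose osc t x := cos (t * x `^ (- alpha) + c).
have cosc t x : 0 < x -> {for x, continuous (osc t)} by move=> x0; rewrite /osc; prove_continuous.
have osc1 t x : `|osc t x| <= 1 by rewrite ler_norml cos_geN1 cos_le1.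
have iosc t : mu.-integrable `]0, +oo[ (EFin \o (fun x => osc t x * f x)).
  apply: (integrable_dominated mD _ (iB _ mD)).
    by apply: continuous_pos_measurable => x x0; apply: continuousM; [exact: cosc|exact: cf].
  move=> x; rewrite /= in_itv/= andbT => x0; rewrite normrM (le_trans _ (fM _ x0))//.
  by rewrite ler_piMl.
have imon t i : mu.-integrable `]0, 1] (EFin \o (fun x => x ^+ i * osc t x)).
  apply: (integrable_dominated mD1 _ (integrable_powR (ltr0Sn _ i))).
    apply: continuous_pos_measurable01 => x x0; apply: continuousM; last exact: cosc.
    by prove_continuous.
  move=> x; rewrite /= in_itv/= => /andP[x0 _].
  rewrite -natr1 addrK powR_mulrn ?(ltW x0)// normrM ger0_norm ?exprn_ge0 ?(ltW x0)//.
  by rewrite ler_piMr// exprn_ge0// ltW.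
have irem t : mu.-integrable `]0, 1] (EFin \o (fun x => osc t x * (f x - P x))).
  apply: (integrable_dominated mD1 _ (integrable_powRZ K (ltr0Sn _ N))).
    apply: continuous_pos_measurable01 => x x0; apply: continuousM; first exact: cosc.
    by apply: continuousB; [exact: cf|exact: cP].
  move=> x; rewrite /= in_itv/= => /andP[x0 x1].
  rewrite -natr1 addrK powR_mulrn ?(ltW x0)// normrM.
  have := fK x; rewrite (ltW x0) x1 => /(_ isT); apply: le_trans.
  by rewrite ler_piMl.
have /choice[psi Hpsi] : forall i : nat, exists psi : R -> R, (forall k, Ck k psi) /\
   forall t, 0 <= t -> \int[mu]_(x in `]0, 1]) (x ^+ i * osc t x) =
   cos (c - i.+1%:R / alpha * (pi / 2)) * radial_singular alpha (i.+1%:R / alpha) t + psi t.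
  by move=> i; have [psi ? ?] := monomial_expansion c i al0; exists psi.
(* The three parts come from the monomials, the Taylor remainder on [(0, 1]] and the tail. The order
   [k] limits only the second. *)
exists (fun t => \sum_(i < N) a i * psi i t + (\int[mu]_(x in `]0, 1]) (osc t x * (f x - P x)) +
  \int[mu]_(x in `]1, +oo[) (osc t x * f x))).
  apply: CkD.
    by apply: Ck_sum => i; apply: CkZ; case: (Hpsi i).
  apply: CkD.
  - apply: (@Ck_oscillatory _ _ alpha c (fun x => f x - P x)) => //.
    + by move=> x; rewrite /= in_itv/= => /andP[].
    + by move=> x; apply: continuousB; [exact: cf|exact: cP].
    + move=> j jk; have Nj : 0 < N.+1%:R - alpha * j%:R.
        by rewrite subr_gt0 (le_lt_trans _ alk)// ler_pM2l// ler_nat.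
      exists (fun x => K * x `^ (N.+1%:R - alpha * j%:R - 1)); first exact: integrable_powRZ.
      move=> x; rewrite /= in_itv/= => /andP[x0 x1].
      have := fK x; rewrite (ltW x0) x1 => /(_ isT) fKx.
      rewrite normrM -powR_mulrn ?powR_ge0// -powRrM ger0_norm ?powR_ge0//.
      have -> : N.+1%:R - alpha * j%:R - 1 = N%:R + - alpha * j%:R by rewrite -natr1; ring.
      rewrite powRD; last by rewrite (gt_eqF x0) implybT.
      by rewrite powR_mulrn ?(ltW x0)// mulrA [leRHS]mulrC ler_wpM2l// powR_ge0.
  - apply: (@Ck_oscillatory _ _ alpha c f) => //.
    + by move=> x; rewrite /= in_itv/= andbT; exact: lt_trans.
    + move=> j jk; exists (fun x => M * \1_`[0, X] x); first exact: iB.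
      move=> x; rewrite /= in_itv/= andbT => x1; have x0 := lt_trans ltr01 x1.
      rewrite normrM (le_trans _ (fM _ x0))// ler_piMl// ger0_norm ?exprn_ge0 ?powR_ge0//.
      rewrite exprn_ile1 ?powR_ge0// powRN invf_le1 ?powR_gt0//.
      by rewrite -(powRr0 x) ler_powR// ltW.
move=> t t0.
rewrite (@itv_bndbnd_setU _ _ _ (BRight 1)) ?bnd_simp//.
rewrite Rintegral_setU//; last 2 first.
- by rewrite -itv_bndbnd_setU ?bnd_simp//; exact: iosc.
- apply/disj_set2P; rewrite -subset0 => x [] /=; rewrite !in_itv/= andbT.
  by move=> /andP[_ x1] /(le_lt_trans x1); rewrite ltxx.
rewrite !addrA; congr (_ + _).
have -> : \int[mu]_(x in `]0, 1]) (cos (t * x `^ (- alpha) + c) * f x) =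
  \int[mu]_(x in `]0, 1]) (\sum_(i < N) a i * (x ^+ i * osc t x) + osc t x * (f x - P x)).
  apply: eq_Rintegral => x _; rewrite -/(osc t x).
  have -> : \sum_(i < N) a i * (x ^+ i * osc t x) = osc t x * P x.
    by rewrite /P mulr_sumr; apply: eq_bigr => i _; ring.
  by ring.
have iamon i : mu.-integrable `]0, 1] (EFin \o (fun x => a i * (x ^+ i * osc t x))).
  exact: integrable_scale.
rewrite RintegralD//; last exact: (integrable_Rsum _ mD1 iamon).
congr (_ + _).
rewrite (Rintegral_sum _ mD1 iamon) -big_split/=; apply: eq_bigr => i _.
rewrite RintegralZl//.
by rewrite (Hpsi i).2// mulrDr.
Qed.

End oscillatory_expansion.

(** * Complex coefficients and the expansion of the integral *)

Section complex_expansion.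
Context {R : realType}.
Notation mu := (@lebesgue_measure R).

Lemma cisD (a b : R) : cis (a + b) = cis a * cis b.
Proof. by rewrite /cis cosD sinD; simpc; congr (_ +i* _); rewrite addrC [sin a * _]mulrC. Qed.

(** The phase of the rotation meets the sign [(-1)^m] of the logarithmic coefficient; their product
    is the power [i^m] found in [B_coef]. *)
Lemma cis_natmul_pihalf (m : nat) : cis (- (m%:R * (pi / 2))) * ((-1) ^+ m)%:C = 'i%C ^+ m :> R[i].
Proof.
elim: m => [|m IH].
  by rewrite mul0r oppr0 /cis cos0 sin0 !expr0; simpc.
have -> : - (m.+1%:R * (pi / 2)) = - (m%:R * (pi / 2)) + - (pi / 2) :> R.
  by rewrite -natr1; ring.
rewrite cisD !exprS rmorphM/= -IH.
have -> : cis (- (pi / 2)) = - 'i%C :> R[i].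
  by rewrite /cis cosN sinN cos_pihalf sin_pihalf; simpc.
by rewrite rmorphN rmorph1; ring.
Qed.

(** For each [n] only one of the two coefficients can be nonzero, matching the alternative between
    [power_coef] and [log_coef]; the common phase is that of the rotation. *)
Lemma singular_term (alpha : R) (phi : R -> R) (n : nat) (t : R) : 0 < alpha ->
  A_coef alpha phi n * (t `^ (n%:R / alpha))%:C +
  B_coef alpha phi n * (t `^ (n%:R / alpha) * ln t)%:C =
  (taylor_coef phi n)%:C * cis (- (n%:R / alpha * (pi / 2))) *
    (radial_singular alpha (n%:R / alpha) t)%:C.
Proof.
move=> al0; rewrite /A_coef /B_coef /radial_singular /power_coef /log_coef.
have -> : n%:R / (2 * alpha) * pi = n%:R / alpha * (pi / 2) :> R.
  by field; rewrite gt_eqF.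
set s : R := n%:R / alpha; set T := taylor_coef phi n.
case: ifPn => [sN|_].
  set m := Num.truncn s.
  have -> : s = m%:R by rewrite truncnK.
  rewrite -cis_natmul_pihalf !(rmorphM, rmorphD, rmorphN, rmorph0, fmorphV, rmorph_nat)/=.
  by ring.
rewrite !(rmorphM, rmorphD, rmorph0, fmorphV)/=; ring.
Qed.

(** [ceil x - 1] stays strictly below [x], even for an integer [x]; this strictness is what
    integrability at 0 requires. *)
Lemma remainder_order_lt (alpha : R) (N : nat) : 0 < alpha ->
  alpha * (remainder_order alpha N)%:R < N.+1%:R.
Proof.
move=> al0; rewrite /remainder_order; set x := N.+1%:R / alpha.
have x0 : 0 < x by rewrite divr_gt0.
have cx : 0 < Num.ceil x by rewrite ceil_gt0.
have : (`|Num.ceil x - 1|%N)%:R < x.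
  rewrite natr_absz ger0_norm; last by rewrite subr_ge0 -gtz0_ge1.
  by have /andP[] := ceil_itv x.
by rewrite /x ltr_pdivlMr// mulrC.
Qed.

Lemma I_integral_expansion (alpha : R) (J : set R) (phi : R -> R) (N : nat) :
  0 < alpha -> smooth_on J phi -> compact (support_closure phi) ->
  support_closure phi `<=` J ->
  exists2 psi : R -> R[i],
    Ck (remainder_order alpha N) (fun x => complex.Re (psi x)) /\
    Ck (remainder_order alpha N) (fun x => complex.Im (psi x)) &
    forall t : R, 0 <= t ->
      I_integral alpha phi t =
        \sum_(1 <= n < N.+1) A_coef alpha phi n * (t `^ (n%:R / alpha))%:C
      + \sum_(1 <= n < N.+1) B_coef alpha phi n * (t `^ (n%:R / alpha) * ln t)%:C
      + psi t.
Proof.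
move=> al0 phiJ cphi sphi.
have dphi := derivable_derive1n_support phiJ sphi.
have cf : continuous phi by move=> x; apply: derivable_continuous; exact: (dphi 0%N).
have [M _ [X X1 phiM]] := compact_support_bounded cf cphi.
have expansion c := oscillatory_expansion c al0 (remainder_order_lt N al0) dphi X1 phiM.
have [psi0 C0 H0] := expansion 0.
have [psi1 C1 H1] := expansion (- (pi / 2)).
exists (fun t => psi0 t +i* psi1 t); first by split.
move=> t t0; rewrite -big_split/=.
under eq_bigr do rewrite singular_term//.
rewrite big_add1/= big_mkord.
have -> : I_integral alpha phi t =
  (\int[mu]_(x in `]0, +oo[) (cos (t * x `^ (- alpha) + 0) * phi x)) +i*
  (\int[mu]_(x in `]0, +oo[) (cos (t * x `^ (- alpha) + - (pi / 2)) * phi x)).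
  rewrite /I_integral /complex_integral; congr (_ +i* _); apply: eq_Rintegral => x _ /=.
    by rewrite mulr0 subr0 powRN addr0.
  by rewrite mulr0 add0r powRN cosBpihalf.
rewrite H0// H1//.
have -> : \sum_(i < N) (taylor_coef phi i.+1)%:C * cis (- (i.+1%:R / alpha * (pi / 2))) *
    (radial_singular alpha (i.+1%:R / alpha) t)%:C =
  (\sum_(i < N) derive1n i phi 0 / i`!%:R *
     (cos (0 - i.+1%:R / alpha * (pi / 2)) * radial_singular alpha (i.+1%:R / alpha) t)) +i*
  (\sum_(i < N) derive1n i phi 0 / i`!%:R *
     (cos (- (pi / 2) - i.+1%:R / alpha * (pi / 2)) * radial_singular alpha (i.+1%:R / alpha) t)).
  elim: (N) => [|n IH]; first by rewrite !big_ord0.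
  rewrite !big_ord_recr/= IH; simpc.
  rewrite /taylor_coef/= ?sub0r [- (pi / 2) - _]addrC cosBpihalf.
  by congr (_ +i* _); rewrite mulrA.
by simpc.
Qed.

End complex_expansion.

Theorem theorem1p1 (R : realType) (alpha : R) (J : set R) (phi : R -> R)
  (alpha_gt0 : 0 < alpha)
  (J_open : open J) (J_interval : is_interval J) (J0 : J 0)
  (phi_smooth : smooth_on J phi)
  (phi_compact : compact (support_closure phi))
  (phi_support : support_closure phi `<=` J) :
  (rational alpha ->
     forall N : nat, (0 < N)%N ->
     exists psi : R -> R[i],
       Ck_half_line (remainder_order alpha N) psi /\
       forall t : R, 0 <= t ->
         I_integral alpha phi t =
           \sum_(1 <= n < N.+1)
             A_coef alpha phi n * (t `^ (n%:R / alpha))%:C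
           + \sum_(1 <= n < N.+1)
               B_coef alpha phi n * (t `^ (n%:R / alpha) * ln t)%:C
           + psi t) /\
  (irrational alpha ->
     forall N : nat, (0 < N)%N ->
     exists phiN : R -> R[i],
       Ck_real_line (remainder_order alpha N) phiN /\
       forall t : R, 0 <= t ->
         I_integral alpha phi t =
           \sum_(1 <= n < N.+1)
             A_coef alpha phi n * (t `^ (n%:R / alpha))%:C
           + phiN t).
Proof.
split=> [_ N _|alphaN N _].
  have [psi [CRe CIm] H] := I_integral_expansion N alpha_gt0 phi_smooth phi_compact phi_support.
  by exists psi; split=> //; split; exact: Ck_within_of_Ck.
have [psi [CRe CIm] H] := I_integral_expansion N alpha_gt0 phi_smooth phi_compact phi_support.
exists psi; split; first by split; exact: Ck_line_of_Ck.
move=> t t0; rewrite H// [X in _ + X + _]big1_seq ?addr0//.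
move=> n; rewrite mem_index_iota => /andP[_ /andP[n0 _]].
(* If [n / alpha] were a natural number [m], then [m] would be nonzero since [n] is, and
   [alpha = n / m] would be rational. *)
rewrite /B_coef ifF ?mul0r//; apply/negP => /natrP[m nm]; apply: alphaN.
have m0 : m%:R != 0 :> R.
  by rewrite -nm mulf_neq0 ?invr_eq0 ?(gt_eqF alpha_gt0)// pnatr_eq0 -lt0n.
apply/rationalP; exists n%:Z, m.
rewrite -pmulrn -nm invf_div mulrC divfK// pnatr_eq0 -lt0n//.
Qed.
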